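(* Let $\Lambda$ be a left and right noetherian ring and let $M$ be a finitely generated right $\Lambda$-module. (1) The module $M$ is totally reflexive if and only if there is an exact sequence of totally reflexive $\Lambda$-modules $$ \cdots\to G_1\to G_0\xrightarrow{\partial}G_{-1}\to G_{-2}\to\cdots $$ whose $\Lambda$-dual (the sequence obtained by applying $\operatorname{Hom}_\Lambda(-,\Lambda)$) is also exact, such that $M$ is isomorphic to the image of $\partial$. (2) If $M$ has finite reducing Gorenstein dimension, then $$\operatorname{Gdim}_\Lambda M=\sup\{i\in\mathbb{N}\mid\operatorname{Ext}_\Lambda^i(M,\Lambda)\ne0\}.$$
   Context: $\mathbb{N}$ denotes the nonnegative integers; suprema of subsets of $\mathbb{N}$ are taken in $\mathbb{N}\cup\{\infty\}$ (so $\sup\emptyset=0$). Modules are finitely generated right $\Lambda$-modules; left modules are viewed as $\Lambda^{\mathrm{op}}$-modules. Put $(-)^\ast=\operatorname{Hom}_\Lambda(-,\Lambda)$. Transpose: if $P_1\xrightarrow{f}P_0\to M\to0$ is exact with $P_0,P_1$ finitely generated projective, then $\operatorname{Tr}M=\operatorname{Coker}(f^\ast:P_0^\ast\to P_1^\ast)$, well defined up to projective direct summands. Syzygy: $\Omega M$ is the kernel of a surjection from a finitely generated projective module onto $M$, well defined up to projective direct summands; $\Omega^0M=M$ and $\Omega^nM=\Omega(\Omega^{n-1}M)$. A finitely generated $\Lambda$-module $M$ is totally reflexive if $\operatorname{Ext}_\Lambda^i(M,\Lambda)=0=\operatorname{Ext}_{\Lambda^{\mathrm{op}}}^i(\operatorname{Tr}M,\Lambda)$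 for all $i\ge1$. The Gorenstein dimension $\operatorname{Gdim}_\Lambda M$ is the infimum of integers $n\ge0$ such that there is an exact sequence $0\to G_n\to\cdots\to G_0\to M\to0$ with every $G_i$ totally reflexive ($\infty$ if there is none). The reducing Gorenstein dimension of $M$ is defined as follows. It is $0$ if and only if $\operatorname{Gdim}_\Lambda M<\infty$. If $\operatorname{Gdim}_\Lambda M=\infty$, it is the minimum of the integers $s>0$ for which there exist exact sequences $$0\to M_{i-1}^{\oplus a_i}\to M_i\to(\Omega^{n_i}M_{i-1})^{\oplus b_i}\to0\qquad(i=1,\dots,s)$$ of finitely generated $\Lambda$-modules with $n_i\ge0$, $a_i,b_i>0$, $M_0=M$ and $\operatorname{Gdim}_\Lambda M_s<\infty$; it is $\infty$ if no such exact sequences exist. *)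

(* Defs.v *)
From HB Require Import structures.
From mathcomp Require Import all_boot all_order all_algebra.
From mathcomp Require Import boolp classical_sets.

Set Implicit Arguments.
Unset Strict Implicit.
Unset Printing Implicit Defensive.

Import GRing.Theory.
Local Open Scope ring_scope.

(* Modules over R are MathComp left modules ([lmodType R]).  A right L-module
   is a left module over the converse ring [L^c]: [a *: x] is x.a.  The
   regular right module L_L is [(L^c)^o], the regular left module is [L^o].
   Rings are not assumed to be nonzero, whence [pzRingType]. *)
Notation rmodType L := (lmodType L^c).

Section Modules.
Variable R : pzRingType.
Implicit Types U V W M N P : lmodType R.

Definition surjective (A B : Type) (f : A -> B) : Prop :=
  forall y, exists x, f x = y.

Definition isomorphic U V : Prop := exists f : {linear U -> V}, bijective f.

Definition is_zero_module U : Prop := forall x : U, x = 0.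

Definition finitely_generated M : Prop :=
  exists (n : nat) (x : 'I_n -> M),
    forall v : M, exists c : 'I_n -> R, v = \sum_(i < n) c i *: x i.

Definition noetherian_module M : Prop :=
  forall S : {pred M}, GRing.submod_closed S ->
    exists (n : nat) (x : 'I_n -> M),
      forall v : M, v \in S <-> exists c : 'I_n -> R, v = \sum_(i < n) c i *: x i.

Definition projective P : Prop :=
  forall (U V : lmodType R) (p : {linear U -> V}) (f : {linear P -> V}),
    surjective p -> exists g : {linear P -> U}, forall x, p (g x) = f x.

End Modules.

Definition left_noetherian (L : pzRingType) : Prop :=
  noetherian_module (L^o : lmodType L).

Definition right_noetherian (L : pzRingType) : Prop :=
  noetherian_module ((L^c)^o : rmodType L).

(* Exactness of A -> B -> C at B. *)
Definition exact (A B : Type) (C : nmodType) (f : A -> B) (g : B -> C) : Prop :=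
  forall y, g y = 0 <-> exists x, f x = y.

Definition short_exact (R : pzRingType) (U V W : lmodType R)
    (f : {linear U -> V}) (g : {linear V -> W}) : Prop :=
  [/\ injective f, exact f g & surjective g].

Section Ext.
Variable R : pzRingType.
Implicit Types M N : lmodType R.

Record proj_resolution M := ProjResolution {
  term : nat -> lmodType R;
  bd : forall n, {linear term n.+1 -> term n};
  aug : {linear term 0%N -> M};
  term_projective : forall n, projective (term n);
  aug_surjective : surjective aug;
  aug_exact : exact (bd 0%N) aug;
  bd_exact : forall n, exact (bd n.+1) (bd n)
}.

(* Cocycles and coboundaries of the complex Hom_R(P, N). *)
Definition cocycle M (P : proj_resolution M) N (i : nat)
    (f : {linear term P i -> N}) : Prop :=
  forall x, f (bd P i x) = 0.

Definition coboundary M (P : proj_resolution M) N (i : nat) :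
    {linear term P i -> N} -> Prop :=
  match i with
  | 0%N => fun f => forall x, f x = 0
  | j.+1 => fun f => exists g : {linear term P j -> N},
                       forall x, f x = g (bd P j x)
  end.

(* Ext^i_R(M, N) = 0, where Ext^i_R(M, N) = H^i(Hom_R(P, N)).  Every module
   has a projective resolution P, and whether H^i(Hom_R(P, N)) vanishes does
   not depend on P. *)
Definition Ext_eq0 (i : nat) M N : Prop :=
  exists P : proj_resolution M,
    forall f : {linear term P i -> N}, cocycle f -> coboundary f.

End Ext.

(* The dual Hom_L(M, L) of a right module M is a left module: (a f)(m) = a f(m). *)
Definition dual (L : pzRingType) (M : rmodType L) : Type :=
  {linear M -> (L^c)^o}.

Section Dual.
Variables (L : pzRingType) (M : rmodType L).
Implicit Types f g h : dual M.

HB.instance Definition _ := gen_eqMixin (dual M).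
HB.instance Definition _ := gen_choiceMixin (dual M).

Definition dual_fun f : {linear M -> (L^c)^o} := f.

Lemma dual_funP f g : dual_fun f =1 dual_fun g -> f = g.
Proof.
case: f g => [f [[f1] [f2]]] [g [[g1] [g2]]] /funext efg.
rewrite /dual_fun /= in efg; subst g.
by rewrite (Prop_irrelevance f1 g1) (Prop_irrelevance f2 g2).
Qed.

Definition dual_zero : dual M := (\0 : M -> (L^c)^o).
Definition dual_opp f : dual M := \- dual_fun f.
Definition dual_add f g : dual M := dual_fun f \+ dual_fun g.

Definition dual_scale_fun (a : L) f : M -> (L^c)^o :=
  fun x => (a * (dual_fun f x : L) : L).

Fact dual_scale_linear a f : linear (dual_scale_fun a f).
Proof.
move=> b x y; rewrite /dual_scale_fun linearP.
change (a * ((dual_fun f x : L) * (b : L) + (dual_fun f y : L))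
   = a * (dual_fun f x : L) * (b : L) + a * (dual_fun f y : L)).
by rewrite mulrDr mulrA.
Qed.

HB.instance Definition _ a f :=
  GRing.isLinear.Build L^c M (L^c)^o _ (dual_scale_fun a f)
    (dual_scale_linear a f).

Definition dual_scale a f : dual M := dual_scale_fun a f.

Fact dual_addA : associative dual_add.
Proof. by move=> f g h; apply: dual_funP => x; apply: addrA. Qed.
Fact dual_addC : commutative dual_add.
Proof. by move=> f g; apply: dual_funP => x; apply: addrC. Qed.
Fact dual_add0 : left_id dual_zero dual_add.
Proof. by move=> f; apply: dual_funP => x; apply: add0r. Qed.
Fact dual_addN : left_inverse dual_zero dual_opp dual_add.
Proof. by move=> f; apply: dual_funP => x; apply: addNr. Qed.

HB.instance Definition _ :=
  GRing.isZmodule.Build (dual M) dual_addA dual_addC dual_add0 dual_addN.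

Fact dual_scaleA a b f : dual_scale a (dual_scale b f) = dual_scale (a * b) f.
Proof. by apply: dual_funP => x; apply: (@mulrA L). Qed.
Fact dual_scale1 : left_id 1 dual_scale.
Proof. by move=> f; apply: dual_funP => x; apply: (@mul1r L). Qed.
Fact dual_scaleDr : right_distributive dual_scale +%R.
Proof. by move=> a f g; apply: dual_funP => x; apply: (@mulrDr L). Qed.
Fact dual_scaleDl f : {morph dual_scale^~ f : a b / a + b}.
Proof. by move=> a b; apply: dual_funP => x; apply: (@mulrDl L). Qed.

HB.instance Definition _ :=
  GRing.Zmodule_isLmodule.Build L (dual M)
    dual_scaleA dual_scale1 dual_scaleDr dual_scaleDl.

End Dual.

Definition dual_map (L : pzRingType) (U V : rmodType L) (f : {linear U -> V})
    (h : dual V) : dual U :=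
  dual_fun h \o f.

Fact dual_map_linear (L : pzRingType) (U V : rmodType L) (f : {linear U -> V}) :
  linear (dual_map f).
Proof. by move=> a g h; apply: dual_funP. Qed.

HB.instance Definition _ (L : pzRingType) (U V : rmodType L)
    (f : {linear U -> V}) :=
  GRing.isLinear.Build L (dual V) (dual U) _ (dual_map f) (dual_map_linear f).

(* T is a transpose of M, i.e. the cokernel of the dual of some presentation
   of M by finitely generated projective modules. *)
Definition is_transpose (L : pzRingType) (M : rmodType L) (T : lmodType L) : Prop :=
  exists (P1 P0 : rmodType L) (f : {linear P1 -> P0}) (e : {linear P0 -> M})
         (q : {linear dual P1 -> T}),
    [/\ finitely_generated P1 /\ projective P1,
        finitely_generated P0 /\ projective P0,
        exact f e /\ surjective e &
        exact (dual_map f) q /\ surjective q].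

Definition is_syzygy (R : pzRingType) (M K : lmodType R) : Prop :=
  exists (P : lmodType R) (j : {linear K -> P}) (p : {linear P -> M}),
    [/\ finitely_generated P, projective P & short_exact j p].

Fixpoint is_nth_syzygy (R : pzRingType) (n : nat) (M K : lmodType R) : Prop :=
  match n with
  | 0%N => isomorphic M K
  | m.+1 => exists K' : lmodType R, is_nth_syzygy m M K' /\ is_syzygy K' K
  end.

(* The vanishing of Ext(Tr M, L) does not depend on the choice of Tr M. *)
Definition totally_reflexive (L : pzRingType) (M : rmodType L) : Prop :=
  [/\ finitely_generated M,
      forall i, (1 <= i)%N -> Ext_eq0 i M ((L^c)^o : rmodType L) &
      exists T : lmodType L, is_transpose M T /\
        forall i, (1 <= i)%N -> Ext_eq0 i T (L^o : lmodType L)].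

(* The extended natural numbers; None is infinity. *)
Notation enat := (option nat).

Definition enat_inf (S : set nat) : enat :=
  if pselect (exists n, `[< S n >]) is left exS then Some (ex_minn exS) else None.

(* The least upper bound; in particular the supremum of the empty set is 0. *)
Definition enat_sup (S : set nat) : enat :=
  enat_inf [set m | forall i, S i -> (i <= m)%N].

Section GorensteinDimension.
Variable L : pzRingType.
Implicit Types M N : rmodType L.

(* 0 -> G_n -> ... -> G_0 -> M -> 0, with G_i = 0 for i > n. *)
Definition Gresolution_of_length M (n : nat) : Prop :=
  exists (G : nat -> rmodType L) (d : forall i, {linear G i.+1 -> G i})
         (e : {linear G 0%N -> M}),
    [/\ forall i, (i <= n)%N -> totally_reflexive (G i),
        forall i, (n < i)%N -> is_zero_module (G i),
        surjective e, exact (d 0%N) e & forall i, exact (d i.+1) (d i)].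

Definition Gdim M : enat := enat_inf [set n | Gresolution_of_length M n].

(* 0 -> M^a -> N -> (Omega^n M)^b -> 0 for some choice of Omega^n M. *)
Definition reducing_step M N : Prop :=
  exists (n a b : nat) (K : rmodType L)
         (f : {linear {ffun 'I_a -> M} -> N})
         (g : {linear N -> {ffun 'I_b -> K}}),
    [/\ (0 < a)%N, (0 < b)%N, is_nth_syzygy n M K & short_exact f g].

Definition reducing_chain M (s : nat) : Prop :=
  exists N : nat -> rmodType L,
    [/\ N 0%N = M, forall i, (i <= s)%N -> finitely_generated (N i),
        forall i, (i < s)%N -> reducing_step (N i) (N i.+1) &
        Gdim (N s) <> None].

Definition redGdim M : enat :=
  if Gdim M is Some _ then Some 0%N
  else enat_inf [set s | (0 < s)%N /\ reducing_chain M s].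

End GorensteinDimension.

(* Main.v *)
Require Import Defs.
From HB Require Import structures.
From mathcomp Require Import all_boot all_order all_algebra.
From mathcomp Require Import boolp classical_sets.

Set Implicit Arguments.
Unset Strict Implicit.
Unset Printing Implicit Defensive.

Import GRing.Theory.
Local Open Scope ring_scope.

(* Total reflexivity of M amounts to: M is finitely generated, Ext^i(M, L) = 0 for
   i > 0, and M embeds in a finitely generated projective module with totally
   reflexive cokernel; and the totally reflexive modules form the largest class
   with this property.  Hence if S is a class of finitely generated modules with
   Ext^i(-, L) = 0 for i > 0, and each X in S embeds in a totally reflexive module
   with cokernel an iterated extension of modules in S and totally reflexive ones,
   then every module of S is totally reflexive.

   For (1), S consists of the images of the differentials; conversely the
   complex with terms M + M and differential (x, y) |-> (0, x) works.
   For (2), let Ext^i(M, L) = 0 for i > n.  This passes up a reducing chain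
   M = M_0, ..., M_s, so that M_s, which has finite Gorenstein dimension, has
   Gorenstein dimension at most n.  To descend from M_i to M_(i-1), take n-th
   syzygies: that of M_i is totally reflexive, and the class S of all the k-th
   syzygies of M_(i-1) with k >= n satisfies the condition above. *)

(** * Linear maps, submodules and quotients *)

(** Neither syzygies nor transposes are canonical, and no Ext group is formed. Vanishing of Ext is a
    recursive condition on short exact sequences; pullbacks, pushouts and horseshoes replace the
    long exact sequence, so that the results hold for all choices at once.

    What forces a coinductive argument is a circularity. In the descent of (2) the n-th syzygy of
    M_(i-1) embeds in a totally reflexive module, but the cokernel is built from further copies of
    that same syzygy and from a syzygy of it, so no induction reaches a base case. Membership in a
    largest class tolerates this once the class may be closed under extensions; that is possible
    because Ext^1(-, L) = 0 on S lets the embeddings of the two ends of an extension be combined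
    into an embedding of its middle term.

    In (1) the terms of the complex are totally reflexive rather than projective, which is why a
    split periodic complex made of M itself is enough. *)

Section LinearMaps.
Variable R : pzRingType.
Implicit Types U V W : lmodType R.

Lemma linear_ex U V (f : U -> V) : linear f ->
  exists g : {linear U -> V}, forall x, g x = f x.
Proof.
move=> lf.
pose m := GRing.isLinear.Build R U V _ f lf.
pose g : {linear U -> V} := HB.pack f m.
by exists g.
Qed.

(** Diagram chases give values only up to an existential. A total linear relation is single-valued
    as soon as it relates 0 to 0 alone, and then any choice function for it is linear. *)
Lemma linear_of_rel U V (r : U -> V -> Prop) :
  (forall x, exists y, r x y) ->
  (forall y, r 0 y -> y = 0) ->
  (forall a x y x' y', r x y -> r x' y' -> r (a *: x + x') (a *: y + y')) ->
  exists f : {linear U -> V}, forall x, r x (f x).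
Proof.
move=> rt r0 rl; have [f rf] := choice rt.
have ru x y y' : r x y -> r x y' -> y = y'.
  move=> h h'; apply/subr0_eq/r0.
  have := rl (-1) _ _ _ _ h' h; rewrite !scaleN1r addrC.
  by rewrite subrr addrC addrC.
have lf : linear f by move=> a x y; apply: ru (rf _) _; apply: rl.
by have [g gE] := linear_ex lf; exists g => x; rewrite gE.
Qed.

Lemma linear_fst U V : exists p : {linear (U * V)%type -> U}, forall x, p x = x.1.
Proof. by apply: linear_ex => a x y. Qed.

Lemma linear_snd U V : exists p : {linear (U * V)%type -> V}, forall x, p x = x.2.
Proof. by apply: linear_ex => a x y. Qed.

Lemma linear_inl U V : exists p : {linear U -> (U * V)%type}, forall x, p x = (x, 0).
Proof.
by apply: linear_ex => a x y; congr pair; rewrite /= ?scaler0 ?addr0.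
Qed.

Lemma linear_inr U V : exists p : {linear V -> (U * V)%type}, forall x, p x = (0, x).
Proof.
by apply: linear_ex => a x y; congr pair; rewrite /= ?scaler0 ?addr0.
Qed.

Lemma linear_pair U V W (f : {linear W -> U}) (g : {linear W -> V}) :
  exists p : {linear W -> (U * V)%type}, forall x, p x = (f x, g x).
Proof. by apply: linear_ex => a x y; rewrite !linearP. Qed.

Lemma linear_case U V W (f : {linear U -> W}) (g : {linear V -> W}) :
  exists p : {linear (U * V)%type -> W}, forall x, p x = f x.1 + g x.2.
Proof.
apply: linear_ex => a x y.
by rewrite !linearP /= scalerDr addrACA.
Qed.

Lemma linear_comp U V W (g : {linear V -> W}) (f : {linear U -> V}) :
  exists p : {linear U -> W}, forall x, p x = g (f x).
Proof. by apply: linear_ex => a x y; rewrite !linearP. Qed.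

Lemma linear_id U : exists p : {linear U -> U}, forall x, p x = x.
Proof. exact: linear_ex. Qed.

Lemma linear_zero U V : exists p : {linear U -> V}, forall x, p x = 0.
Proof. by apply: linear_ex => a x y; rewrite scaler0 addr0. Qed.

Lemma linear_sub U V (f g : {linear U -> V}) :
  exists p : {linear U -> V}, forall x, p x = f x - g x.
Proof.
by apply: linear_ex => a x y; rewrite !(linearP f) !(linearP g) scalerBr opprD addrACA.
Qed.

Lemma linear_inj0 U V (f : {linear U -> V}) :
  (forall x, f x = 0 -> x = 0) -> injective f.
Proof.
move=> h x y e; apply/subr0_eq/h.
by rewrite linearB e subrr.
Qed.

Lemma linear_factor_surj U V W (p : {linear U -> V}) (f : {linear U -> W}) :
  surjective p -> (forall x, p x = 0 -> f x = 0) ->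
  exists g : {linear V -> W}, forall x, g (p x) = f x.
Proof.
move=> sp h.
have [g gP] : exists g : {linear V -> W}, forall v, exists2 u, p u = v & f u = g v.
  apply: (@linear_of_rel _ _ (fun v w => exists2 u, p u = v & f u = w)).
  - by move=> v; have [u <-] := sp v; exists (f u), u.
  - by move=> w [u /h fu <-].
  by move=> a ? ? ? ? [u <- <-] [u' <- <-]; exists (a *: u + u'); rewrite linearP.
exists g => x; have [u pu <-] := gP (p x).
by apply/esym/subr0_eq; rewrite -linearB; apply: h; rewrite linearB pu subrr.
Qed.

Lemma linear_factor_inj U V W (j : {linear V -> W}) (f : {linear U -> W}) :
  injective j -> (forall x, exists y, j y = f x) ->
  exists g : {linear U -> V}, forall x, j (g x) = f x.
Proof.
move=> ij h; apply: (@linear_of_rel _ _ (fun u v => j v = f u)) => //.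
  by move=> y; rewrite linear0 => e; apply: ij; rewrite e linear0.
by move=> a x y x' y' e e'; rewrite !linearP e e'.
Qed.

End LinearMaps.

Section Submodule.
Variables (R : pzRingType) (M : lmodType R) (S : M -> Prop).
Hypothesis S0 : S 0.
Hypothesis SL : forall a x y, S x -> S y -> S (a *: x + y).

(* The hypotheses are arguments of the type, so that it carries its module
   structure by unification. *)
Definition submod_of of S 0 & (forall a x y, S x -> S y -> S (a *: x + y)) : Type :=
  {x : M | S x}.
Local Notation T := (submod_of S0 SL).

HB.instance Definition _ := gen_eqMixin T.
HB.instance Definition _ := gen_choiceMixin T.

Let val (u : T) : M := sval u.
Let val_inj : injective val.
Proof. by case=> u hu [v hv]; apply: eq_exist. Qed.

Let SD x y : S x -> S y -> S (x + y).
Proof. by move=> hx hy; rewrite -[x]scale1r; apply: SL. Qed.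
Let SZ a x : S x -> S (a *: x).
Proof. by move=> hx; rewrite -[a *: x]addr0; apply: SL. Qed.
Let SN x : S x -> S (- x).
Proof. by rewrite -scaleN1r; apply: SZ. Qed.

Let zero : T := exist _ 0 S0.
Let opp (u : T) : T := exist _ (- val u) (SN (svalP u)).
Let add (u v : T) : T := exist _ (val u + val v) (SD (svalP u) (svalP v)).
Let scale a (u : T) : T := exist _ (a *: val u) (SZ a (svalP u)).

Fact submod_addA : associative add.
Proof. by move=> x y z; apply: val_inj; apply: addrA. Qed.
Fact submod_addC : commutative add.
Proof. by move=> x y; apply: val_inj; apply: addrC. Qed.
Fact submod_add0 : left_id zero add.
Proof. by move=> x; apply: val_inj; apply: add0r. Qed.
Fact submod_addN : left_inverse zero opp add.
Proof. by move=> x; apply: val_inj; apply: addNr. Qed.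

HB.instance Definition _ :=
  GRing.isZmodule.Build T submod_addA submod_addC submod_add0 submod_addN.

Fact submod_scaleA a b f : scale a (scale b f) = scale (a * b) f.
Proof. by apply: val_inj; apply: scalerA. Qed.
Fact submod_scale1 : left_id 1 scale.
Proof. by move=> x; apply: val_inj; apply: scale1r. Qed.
Fact submod_scaleDr : right_distributive scale +%R.
Proof. by move=> a x y; apply: val_inj; apply: scalerDr. Qed.
Fact submod_scaleDl f : {morph scale^~ f : a b / a + b}.
Proof. by move=> a b; apply: val_inj; apply: scalerDl. Qed.

HB.instance Definition _ :=
  GRing.Zmodule_isLmodule.Build R T
    submod_scaleA submod_scale1 submod_scaleDr submod_scaleDl.

Lemma submodule_ex :
  exists (K : lmodType R) (j : {linear K -> M}),
    injective j /\ forall y, S y <-> exists x, j x = y.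
Proof.
have lv : linear (val : T -> M) by [].
have [j jE] := linear_ex lv.
exists (T : lmodType R), j; split=> [x y|y]; first by rewrite !jE; apply: val_inj.
split=> [Sy|[x <-]]; last by rewrite jE; apply: svalP.
by exists (exist _ y Sy); rewrite jE.
Qed.

End Submodule.

Section Quotient.
Variables (R : pzRingType) (M : lmodType R) (S : M -> Prop).
Hypothesis S0 : S 0.
Hypothesis SL : forall a x y, S x -> S y -> S (a *: x + y).

(** A coset is encoded by its membership predicate, so that by extensionality congruent elements
    have equal classes. *)
Definition quot_of of S 0 & (forall a x y, S x -> S y -> S (a *: x + y)) : Type :=
  {c : M -> Prop | exists x, c = fun y => S (y - x)}.
Local Notation T := (quot_of S0 SL).

HB.instance Definition _ := gen_eqMixin T.
HB.instance Definition _ := gen_choiceMixin T.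

Let cls (x : M) : T := exist _ (fun y => S (y - x)) (ex_intro _ x erefl).

Let SD x y : S x -> S y -> S (x + y).
Proof. by move=> hx hy; rewrite -[x]scale1r; apply: SL. Qed.
Let SZ a x : S x -> S (a *: x).
Proof. by move=> hx; rewrite -[a *: x]addr0; apply: SL. Qed.
Let SN x : S x -> S (- x).
Proof. by rewrite -scaleN1r; apply: SZ. Qed.

Let clsP x y : cls x = cls y <-> S (x - y).
Proof.
split=> [/(congr1 sval) /= e|h].
  by have := congr1 (fun c => c x) e; rewrite /= subrr => <-.
apply: eq_exist; apply: funext => z; apply: propext; split=> h'.
  by have := SD h' h; rewrite addrA subrK.
by have := SD h' (SN h); rewrite opprB addrA subrK.
Qed.

Let rep (u : T) : M := projT1 (cid (svalP u)).
Let repK u : cls (rep u) = u.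
Proof.
case: u => c [x e] /=; rewrite /rep; case: cid => y /= ey.
by apply: eq_exist; apply/esym.
Qed.
Let clsK x : S (rep (cls x) - x).
Proof. by apply/clsP; rewrite repK. Qed.

Let zero : T := cls 0.
Let opp (u : T) : T := cls (- rep u).
Let add (u v : T) : T := cls (rep u + rep v).
Let scale a (u : T) : T := cls (a *: rep u).

Let clsD x y : add (cls x) (cls y) = cls (x + y).
Proof. by apply/clsP; rewrite opprD addrACA; apply: SD. Qed.
Let clsN x : opp (cls x) = cls (- x).
Proof. by apply/clsP; rewrite -opprD; apply: SN. Qed.
Let clsZ a x : scale a (cls x) = cls (a *: x).
Proof. by apply/clsP; rewrite -scalerBr; apply: SZ. Qed.

Fact quot_addA : associative add.
Proof.
by move=> x y z; rewrite -(repK x) -(repK y) -(repK z) !clsD addrA.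
Qed.
Fact quot_addC : commutative add.
Proof. by move=> x y; rewrite -(repK x) -(repK y) !clsD addrC. Qed.
Fact quot_add0 : left_id zero add.
Proof. by move=> x; rewrite -(repK x) clsD add0r. Qed.
Fact quot_addN : left_inverse zero opp add.
Proof. by move=> x; rewrite -(repK x) clsN clsD addNr. Qed.

HB.instance Definition _ :=
  GRing.isZmodule.Build T quot_addA quot_addC quot_add0 quot_addN.

Fact quot_scaleA a b f : scale a (scale b f) = scale (a * b) f.
Proof. by rewrite -(repK f) !clsZ scalerA. Qed.
Fact quot_scale1 : left_id 1 scale.
Proof. by move=> x; rewrite -(repK x) clsZ scale1r. Qed.
Fact quot_scaleDr : right_distributive scale add.
Proof. by move=> a x y; rewrite -(repK x) -(repK y) !(clsD, clsZ) scalerDr. Qed.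
Fact quot_scaleDl f : {morph scale^~ f : a b / a + b >-> add a b}.
Proof. by move=> a b; rewrite -(repK f) !clsZ clsD scalerDl. Qed.

HB.instance Definition _ :=
  GRing.Zmodule_isLmodule.Build R T
    quot_scaleA quot_scale1 quot_scaleDr quot_scaleDl.

Lemma quotient_ex :
  exists (Q : lmodType R) (p : {linear M -> Q}),
    surjective p /\ forall x, p x = 0 <-> S x.
Proof.
have lc : linear (cls : M -> T).
  by move=> a x y; rewrite -clsD -clsZ.
have [p pE] := linear_ex lc.
exists (T : lmodType R), p; split=> [y|x]; first by exists (rep y); rewrite pE repK.
by rewrite pE; split=> [/clsP|h]; [|apply/clsP]; rewrite subr0.
Qed.

End Quotient.

(** * Short exact sequences *)

Section ShortExact.
Variable R : pzRingType.
Implicit Types A B C D E F I J K M N P Q T U V W X Y Z : lmodType R.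

Definition ses U V W : Prop :=
  exists (f : {linear U -> V}) (g : {linear V -> W}), short_exact f g.

Lemma kernel_ex U V (f : {linear U -> V}) :
  exists K (j : {linear K -> U}), injective j /\ exact j f.
Proof.
apply: (submodule_ex (S := fun x => f x = 0)); first exact: linear0.
by move=> a x y fx fy; rewrite linearP fx fy scaler0 addr0.
Qed.

Lemma range_submod U V (f : {linear U -> V}) a x y :
  (exists u, f u = x) -> (exists u, f u = y) -> exists u, f u = a *: x + y.
Proof. by move=> [u <-] [v <-]; exists (a *: u + v); rewrite linearP. Qed.

Lemma cokernel_ex U V (f : {linear U -> V}) :
  exists Q (p : {linear V -> Q}), surjective p /\ exact f p.
Proof.
apply: (quotient_ex (S := fun x => exists u, f u = x)); last exact: range_submod.
by exists 0; rewrite linear0.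
Qed.

Lemma image_ex U V (f : {linear U -> V}) :
  exists I (q : {linear U -> I}) (i : {linear I -> V}),
    [/\ surjective q, injective i & forall x, i (q x) = f x].
Proof.
have [||I [i [ii iE]]] := submodule_ex (S := fun x => exists u, f u = x).
- by exists 0; rewrite linear0.
- exact: range_submod.
have [q qE] : exists q : {linear U -> I}, forall x, i (q x) = f x.
  by apply: linear_factor_inj => // x; apply/iE; exists x.
exists I, q, i; split=> // y.
have [|x fx] := (iE (i y)).2; first by exists y.
by exists x; apply: ii; rewrite qE.
Qed.

Lemma ses_of_surj U V (p : {linear U -> V}) :
  surjective p -> exists K (j : {linear K -> U}), short_exact j p.
Proof. by move=> sp; have [K [j [ij ej]]] := kernel_ex p; exists K, j. Qed.

Lemma ses_of_inj U V (j : {linear U -> V}) :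
  injective j -> exists Q (p : {linear V -> Q}), short_exact j p.
Proof. by move=> ij; have [Q [p [sp ep]]] := cokernel_ex j; exists Q, p. Qed.

Lemma short_exact_eq0 U V W (f : {linear U -> V}) (g : {linear V -> W}) :
  short_exact f g -> forall x, g (f x) = 0.
Proof. by case=> _ e _ x; apply/e; exists x. Qed.

(** Instead of a universal property, the last two clauses say that [T] consists exactly of the
    compatible pairs, which is the form used in chases. *)
Lemma pullback_ex K X Z Y (j : {linear K -> X}) (p : {linear X -> Z})
    (q : {linear Y -> Z}) : short_exact j p ->
  exists T (a : {linear T -> X}) (b : {linear T -> Y}) (j' : {linear K -> T}),
    [/\ short_exact j' b, forall t, p (a t) = q (b t),
        forall k, a (j' k) = j k,
        forall x y, p x = q y -> exists t, a t = x /\ b t = y &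
        forall t, a t = 0 -> b t = 0 -> t = 0].
Proof.
move=> [ij ejp sp].
have [fs fsE] := linear_fst X Y; have [sn snE] := linear_snd X Y.
have [pf pfE] := linear_comp p fs; have [qs qsE] := linear_comp q sn.
have [d dE] := linear_sub pf qs.
have [T [t [it et]]] := kernel_ex d.
have [a aE] := linear_comp fs t; have [b bE] := linear_comp sn t.
have dt x : p (a x) = q (b x).
  apply/subr0_eq; rewrite aE bE -pfE -qsE -dE.
  by apply/et; exists x.
have ext x y : p x = q y -> exists t, a t = x /\ b t = y.
  move=> e; have [|s ts] := (et (x, y)).1.
    by rewrite dE pfE qsE fsE snE e subrr.
  by exists s; rewrite aE bE fsE snE ts.
have inj s : a s = 0 -> b s = 0 -> s = 0.
  rewrite aE bE fsE snE => a0 b0; apply: it; rewrite linear0.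
  by rewrite [t s]surjective_pairing a0 b0.
have [l lE] := linear_inl X Y.
have [lj ljE] := linear_comp l j.
have [j' j'E] : exists j' : {linear K -> T}, forall k, t (j' k) = lj k.
  apply: linear_factor_inj => // k; apply/et.
  by rewrite dE pfE qsE fsE snE ljE lE /= linear0 subr0; apply/ejp; exists k.
have aj k : a (j' k) = j k by rewrite aE j'E ljE lE fsE.
have bj k : b (j' k) = 0 by rewrite bE j'E ljE lE snE.
exists T, a, b, j'; split=> //; split.
- by move=> x y e; apply: ij; rewrite -!aj e.
- move=> s; split=> [bs|[k <-]] //.
  have [|k jk] := (ejp (a s)).1; first by rewrite dt bs linear0.
  exists k; apply/subr0_eq/inj; first by rewrite linearB aj jk subrr.
  by rewrite linearB bj bs subrr.
- by move=> y; have [x px] := sp (q y); have [s [_ <-]] := ext _ _ px; exists s.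
Qed.

(** This compares two covers of the same module, as in Schanuel's lemma. *)
Lemma pullback_ses K X Z J Y : ses K X Z -> ses J Y Z ->
  exists T, ses K T Y /\ ses J T X.
Proof.
move=> [j [p sjp]] [l [q [il elq sq]]].
have [T [a [b [j' [s1 pq aj ext inj]]]]] := pullback_ex q sjp.
exists T; split; first by exists j', b.
have [_ ejp _] := sjp.
have qb t : a t = 0 -> q (b t) = 0 by rewrite -pq => ->; rewrite linear0.
have [l' l'E] : exists l' : {linear J -> T}, forall k, a (l' k) = 0 /\ b (l' k) = l k.
  apply: (@linear_of_rel _ _ _ (fun k t => a t = 0 /\ b t = l k)).
  - by move=> k; apply: ext; rewrite linear0; apply/esym/elq; exists k.
  - by move=> t [at0]; rewrite linear0; apply: inj.
  by move=> c k t k' t' [a1 b1] [a2 b2]; rewrite !linearP a1 a2 b1 b2 scaler0 addr0.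
exists l', a; split.
- by move=> x y e; apply: il; rewrite -!(l'E _).2 e.
- move=> t; split=> [at0|[k <-]]; last by case: (l'E k).
  have [k lk] := (elq _).1 (qb _ at0).
  have [a1 b1] := l'E k.
  by exists k; apply/subr0_eq/inj; rewrite linearB ?a1 ?b1 ?at0 ?lk subrr.
- by move=> x; have [y qy] := sq (p x); have [t [<- _]] := ext _ _ (esym qy); exists t.
Qed.

(** [T] is the cokernel of k |-> (i k, - h k); the last two clauses present it by generators and
    relations. *)
Lemma pushout_ex K X M N (i : {linear K -> X}) (p : {linear X -> M})
    (h : {linear K -> N}) : short_exact i p ->
  exists T (u : {linear X -> T}) (v : {linear N -> T}) (p' : {linear T -> M}),
    [/\ short_exact v p', forall k, u (i k) = v (h k),
        forall x, p' (u x) = p x,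
        forall t, exists x y, t = u x + v y &
        forall x y, u x = v y -> exists2 k, i k = x & h k = y].
Proof.
move=> [ii eip sp].
have [nh nhE] : exists f : {linear K -> N}, forall k, f k = - h k.
  by apply: linear_ex => a x y; rewrite linearP opprD scalerN.
have [d dE] := linear_pair i nh.
have [T [c [sc ec]]] := cokernel_ex d.
have [l lE] := linear_inl X N; have [r rE] := linear_inr X N.
have [u uE] := linear_comp c l; have [v vE] := linear_comp c r.
have cE x y : c (x, y) = u x + v y.
  rewrite uE vE -linearD lE rE; congr (c _).
  by congr pair; rewrite /= ?addr0 ?add0r.
have uv k : u (i k) = v (h k).
  apply/subr0_eq; rewrite -linearN -cE; apply/ec.
  by exists k; rewrite dE nhE.
have eq0 x y : u x = v y -> exists2 k, i k = x & h k = y.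
  move=> e; have [|k] := (ec (x, - y)).1.
    by rewrite cE linearN e subrr.
  by rewrite dE nhE => -[ik /oppr_inj hk]; exists k.
have [fs fsE] := linear_fst X N.
have [pf pfE] := linear_comp p fs.
have [p' p'E] : exists p' : {linear T -> M}, forall z, p' (c z) = pf z.
  apply: linear_factor_surj => // z /ec [k <-].
  by rewrite pfE fsE dE; apply/eip; exists k.
have gen t : exists x y, t = u x + v y.
  by have [[x y] <-] := sc t; exists x, y; rewrite cE.
have pu x : p' (u x) = p x by rewrite uE p'E pfE fsE lE.
have pv y : p' (v y) = 0 by rewrite vE p'E pfE fsE rE linear0.
exists T, u, v, p'; split=> //; split.
- apply: linear_inj0 => y vy.
  have [|k ik <-] := eq0 0 y; first by rewrite linear0.
  have -> : k = 0 by apply: ii; rewrite ik linear0.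
  by rewrite linear0.
- move=> t; split=> [|[y <-]] //.
  have [x [y ->]] := gen t; rewrite linearD pu pv addr0 => /eip [k <-].
  by exists (h k + y); rewrite linearD uv.
- by move=> m; have [x <-] := sp m; exists (u x).
Qed.

Lemma pushout_ses K X M N C : ses K X M -> ses K N C ->
  exists T, ses N T M /\ ses X T C.
Proof.
move=> [i [p sip]] [h [q [ih ehq sq]]].
have [T [u [v [p' [s1 uv pu gen eq0]]]]] := pushout_ex h sip.
exists T; split; first by exists v, p'.
have [iv _ _] := s1; have [ii eip sp] := sip.
have [q' q'E] : exists q' : {linear T -> C}, forall t,
    exists x y, t = u x + v y /\ q' t = q y.
  apply: (@linear_of_rel _ _ _ (fun t c => exists x y, t = u x + v y /\ c = q y)).
  - by move=> t; have [x [y ->]] := gen t; exists (q y), x, y.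
  - move=> _ [x [y [e ->]]]; apply/ehq.
    have [|k ik hk] := eq0 (- x) y; last by exists k.
    by rewrite linearN; apply/esym/subr0_eq; rewrite opprK addrC.
  move=> a _ _ _ _ [x [y [-> ->]]] [x' [y' [-> ->]]].
  exists (a *: x + x'), (a *: y + y'); rewrite !linearP; split=> //.
  by rewrite scalerDr addrACA.
have qv y : q' (v y) = q y.
  have [x' [y' [e ->]]] := q'E (v y).
  have [|k ik hk] := eq0 x' (y - y').
    by rewrite linearB e addrK.
  apply/esym/subr0_eq; rewrite -linearB -hk; apply/ehq; by exists k.
have qu x : q' (u x) = 0.
  have [x' [y' [e ->]]] := q'E (u x).
  have [|k ik hk] := eq0 (x - x') y'.
    by rewrite linearB e addrC addKr.
  by rewrite -hk; apply/ehq; exists k.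
exists u, q'; split.
- apply: linear_inj0 => x ux.
  have [|k <- hk] := eq0 x 0; first by rewrite linear0.
  have -> : k = 0 by apply: ih; rewrite hk linear0.
  by rewrite linear0.
- move=> t; split=> [|[x <-]] //.
  have [x [y ->]] := gen t; rewrite linearD qu qv add0r => /ehq [k <-].
  by exists (x + i k); rewrite linearD uv.
- by move=> c; have [y <-] := sq c; exists (v y).
Qed.

(** [K'] is the kernel of the composite P -> B -> C. With [ses_comp_inj], its analogue for
    cokernels, this is how syzygies and cosyzygies are moved along a sequence. *)
Lemma ses_comp_surj K P B A C : ses K P B -> ses A B C ->
  exists K', ses K' P C /\ ses K K' A.
Proof.
move=> [j [p [ij ejp sp]]] [i [q [ii eiq sq]]].
have [r rE] := linear_comp q p.
have sr : surjective r.
  by move=> c; have [b <-] := sq c; have [x <-] := sp b; exists x; rewrite rE.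
have [K' [k [ik ekr _]]] := ses_of_surj sr.
exists K'; split; first by exists k, r.
have [u uE] : exists u : {linear K -> K'}, forall x, k (u x) = j x.
  apply: linear_factor_inj => // x; apply/ekr; rewrite rE.
  by have /ejp -> : exists z, j z = j x by [exists x]; rewrite linear0.
have [pk pkE] := linear_comp p k.
have [v vE] : exists v : {linear K' -> A}, forall x, i (v x) = pk x.
  apply: linear_factor_inj => // x; apply/eiq; rewrite pkE -rE.
  by apply/ekr; exists x.
exists u, v; split.
- by move=> x y e; apply: ij; rewrite -!uE e.
- move=> y; split=> [vy|[x <-]].
    have [|x jx] := (ejp (k y)).1; first by rewrite -pkE -vE vy linear0.
    by exists x; apply: ik; rewrite uE.
  by apply: ii; rewrite vE pkE uE linear0; apply/ejp; exists x.
- move=> a; have [x px] := sp (i a).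
  have [|y ky] := (ekr x).1; first by rewrite rE px; apply/eiq; exists a.
  by exists y; apply: ii; rewrite vE pkE ky.
Qed.

Lemma ses_comp_inj A B C F D : ses A B C -> ses B F D ->
  exists E, ses A F E /\ ses C E D.
Proof.
move=> [i [q [ii eiq sq]]] [u [v [iu euv sv]]].
have [r rE] := linear_comp u i.
have ir : injective r by move=> x y; rewrite !rE => /iu /ii.
have [E [w [_ erw sw]]] := ses_of_inj ir.
exists E; split; first by exists r, w.
have [wu wuE] := linear_comp w u.
have [f fE] : exists f : {linear C -> E}, forall x, f (q x) = wu x.
  apply: linear_factor_surj => // x /eiq [a <-]; rewrite wuE.
  by apply/erw; exists a; rewrite rE.
have [g gE] : exists g : {linear E -> D}, forall x, g (w x) = v x.
  apply: linear_factor_surj => // x /erw [a <-]; rewrite rE.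
  by apply/euv; exists (i a).
exists f, g; split.
- apply: linear_inj0 => c; have [b <-] := sq c; rewrite fE wuE => /erw [a].
  by rewrite rE => /iu <-; apply/eiq; exists a.
- move=> e; split=> [|[c <-]].
    have [x <-] := sw e; rewrite gE => /euv [b <-].
    by exists (q b); rewrite fE wuE.
  have [b <-] := sq c; rewrite fE wuE gE; apply/euv; by exists b.
- by move=> d; have [x <-] := sv d; exists (w x); rewrite gE.
Qed.

(** * Horseshoe lemmas *)

Lemma horseshoe (A B C KA PA KC PC : lmodType R) (j : {linear A -> B}) (p : {linear B -> C})
    (pC : {linear PC -> C}) (s : {linear PC -> B}) (iC : {linear KC -> PC}) :
  short_exact j p -> ses KA PA A -> short_exact iC pC ->
  (forall x, p (s x) = pC x) ->
  exists K, ses KA K KC /\ ses K (PA * PC)%type B.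
Proof.
move=> [ij ejp sp] [iA [pA [iiA eA sA]]] [iiC eC sC] ps.
have [jp jpE] := linear_comp j pA.
have [r rE] := linear_case jp s.
have sr : surjective r.
  move=> b; have [x ex] := sC (p b).
  have [|a ja] := (ejp (b - s x)).1; first by rewrite linearB ps ex subrr.
  have [y ey] := sA a.
  by exists (y, x); rewrite rE jpE /= ey ja subrK.
have [K [k [ik ekr _]]] := ses_of_surj sr.
exists K; split; last by exists k, r.
have [sn snE] := linear_snd PA PC; have [sk skE] := linear_comp sn k.
have pC2 x : pC x.2 = p (r x).
  rewrite rE jpE linearD -ps.
  by rewrite (_ : p (j _) = 0) ?add0r //; apply/ejp; exists (pA x.1).
have [v vE] : exists v : {linear K -> KC}, forall x, iC (v x) = sk x.
  apply: linear_factor_inj => // x; apply/eC; rewrite skE snE pC2.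
  by rewrite (_ : r (k x) = 0) ?linear0 //; apply/ekr; exists x.
have [l lE] := linear_inl PA PC; have [li liE] := linear_comp l iA.
have [u uE] : exists u : {linear KA -> K}, forall x, k (u x) = li x.
  apply: linear_factor_inj => // x; apply/ekr.
  rewrite rE jpE liE lE /= linear0 addr0.
  by rewrite (_ : pA _ = 0) ?linear0 //; apply/eA; exists x.
exists u, v; split.
- by move=> x y e; have := congr1 k e; rewrite !uE !liE !lE => -[/iiA].
- move=> y; split=> [vy|[x <-]].
    have k2 : (k y).2 = 0 by rewrite -snE -skE -vE vy linear0.
    have : r (k y) = 0 by apply/ekr; exists y.
    rewrite rE jpE k2 linear0 addr0 => j0.
    have [|x ex] := (eA (k y).1).1; first by apply: ij; rewrite j0 linear0.
    exists x; apply: ik; rewrite uE liE lE ex -k2.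
    by rewrite -surjective_pairing.
  by apply: iiC; rewrite vE skE snE uE liE lE linear0.
- move=> c.
  have [|a ja] := (ejp (- s (iC c))).1.
    rewrite linearN ps (_ : pC _ = 0) ?oppr0 //; apply/eC; by exists c.
  have [x ex] := sA a.
  have [|y ky] := (ekr (x, iC c)).1; first by rewrite rE jpE /= ex ja addNr.
  by exists y; apply: iiC; rewrite vE skE snE ky.
Qed.

(* Only the embedding of [A] has to be extended to [B], which is where the vanishing
   of Ext^1(C, FA) enters. *)
Lemma cohorseshoe (A B C FA A' FC C' : lmodType R) (j : {linear A -> B}) (p : {linear B -> C})
    (jA : {linear A -> FA}) (s : {linear B -> FA}) (qA : {linear FA -> A'}) :
  short_exact j p -> short_exact jA qA -> ses C FC C' ->
  (forall x, s (j x) = jA x) ->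
  exists D, ses A' D C' /\ ses B (FA * FC)%type D.
Proof.
move=> [ij ejp sp] [ijA eA sA] [jC [qC [ijC eC sC]]] sj.
have [jp jpE] := linear_comp jC p.
have [r rE] := linear_pair s jp.
have ir : injective r.
  apply: linear_inj0 => b; rewrite rE jpE => -[sb pb].
  have /ejp [a ea] : p b = 0 by apply: ijC; rewrite pb linear0.
  move: sb; rewrite -ea sj => ja.
  by rewrite (_ : a = 0) ?linear0 //; apply: ijA; rewrite ja linear0.
have [D [w [_ erw sw]]] := ses_of_inj ir.
exists D; split; last by exists r, w.
have [l lE] := linear_inl FA FC; have [wl wlE] := linear_comp w l.
have [f fE] : exists f : {linear A' -> D}, forall x, f (qA x) = wl x.
  apply: linear_factor_surj => // x /eA [a <-]; rewrite wlE lE; apply/erw.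
  exists (j a); rewrite rE sj jpE (_ : p _ = 0) ?linear0 //.
  by apply/ejp; exists a.
have [sn snE] := linear_snd FA FC; have [qs qsE] := linear_comp qC sn.
have [g gE] : exists g : {linear D -> C'}, forall x, g (w x) = qs x.
  apply: linear_factor_surj => // x /erw [b <-].
  by rewrite qsE snE rE jpE; apply/eC; exists (p b).
exists f, g; split.
- apply: linear_inj0 => a'; have [x <-] := sA a'; rewrite fE wlE lE => /erw [b].
  rewrite rE jpE => -[sb jb].
  have /ejp [a ea] : p b = 0 by apply: ijC; rewrite jb linear0.
  by apply/eA; exists a; rewrite -sj ea.
- move=> d; split=> [|[a' <-]].
    have [[x y] <-] := sw d; rewrite gE qsE snE /= => /eC [c ec].
    have [b eb] := sp c.
    exists (qA (x - s b)); rewrite fE wlE lE.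
    apply/subr0_eq; rewrite -linearB; apply/erw; exists (- b).
    rewrite linearN rE jpE eb ec.
    congr pair; rewrite /= ?sub0r //.
    by rewrite addrC addKr.
  have [x <-] := sA a'; rewrite fE wlE lE gE qsE snE /=; exact: linear0.
- move=> c'; have [y <-] := sC c'; exists (w (0, y)); by rewrite gE qsE snE.
Qed.

(** * Split sequences and finite powers *)

Lemma projective_lift P X Z (p : {linear X -> Z}) (q : {linear P -> Z}) :
  projective P -> surjective p -> exists s : {linear P -> X}, forall x, p (s x) = q x.
Proof. by move=> prP sp; have [s sE] := prP _ _ p q sp; exists s. Qed.

Lemma projective_section P X (p : {linear X -> P}) :
  projective P -> surjective p -> exists s : {linear P -> X}, forall x, p (s x) = x.
Proof.
move=> prP sp; have [i iE] := linear_id P.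
by have [s sE] := projective_lift i prP sp; exists s => x; rewrite sE.
Qed.

(** [PA] may be any cover of [A]: in [Gdim_le_split] it is totally reflexive. *)
Lemma horseshoe_proj A B C (KA PA KC PC : lmodType R) : projective PC ->
  ses A B C -> ses KA PA A -> ses KC PC C ->
  exists K, ses KA K KC /\ ses K (PA * PC)%type B.
Proof.
move=> prP [j [p sjp]] hA [iC [pC hC]].
have [_ _ sp] := sjp.
have [s sE] := projective_lift pC prP sp.
exact: horseshoe sjp hA hC sE.
Qed.

Lemma ses_split_retraction U V W (j : {linear U -> V}) (p : {linear V -> W})
    (s : {linear W -> V}) : short_exact j p -> (forall x, p (s x) = x) ->
  exists r : {linear V -> U}, [/\ forall x, r (j x) = x, forall x, r (s x) = 0 &
    forall x, x = j (r x) + s (p x)].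
Proof.
move=> [ij ejp sp] ps.
have [sp' sp'E] := linear_comp s p; have [i iE] := linear_id V.
have [d dE] := linear_sub i sp'.
have [r rE] : exists r : {linear V -> U}, forall x, j (r x) = d x.
  by apply: linear_factor_inj => // x; apply/ejp; rewrite dE iE sp'E linearB ps subrr.
exists r; split=> x.
- apply: ij; rewrite rE dE iE sp'E.
  by rewrite (_ : p (j x) = 0) ?(linear0 s) ?subr0 //; apply/ejp; exists x.
- by apply: ij; rewrite rE dE iE sp'E ps subrr linear0.
- by rewrite rE dE iE sp'E subrK.
Qed.

Lemma ses_split_swap U V W (j : {linear U -> V}) (p : {linear V -> W})
    (s : {linear W -> V}) : short_exact j p -> (forall x, p (s x) = x) -> ses W V U.
Proof.
move=> sjp ps; have [r [rj rs e]] := ses_split_retraction sjp ps.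
exists s, r; split.
- by move=> x y exy; rewrite -(ps x) exy ps.
- move=> x; split=> [r0|[w <-]] //; exists (p x).
  by rewrite [RHS]e r0 linear0 add0r.
- by move=> u; exists (j u).
Qed.

Lemma short_exact_retraction U V W (j : {linear U -> V}) (p : {linear V -> W})
    (r : {linear V -> U}) : short_exact j p -> (forall x, r (j x) = x) ->
  exists s : {linear W -> V}, (forall x, p (s x) = x) /\ short_exact s r.
Proof.
move=> [ij ejp sp] rj.
have [jr jrE] := linear_comp j r; have [i iE] := linear_id V.
have [d dE] := linear_sub i jr.
have [s sE] : exists s : {linear W -> V}, forall x, s (p x) = d x.
  by apply: linear_factor_surj => // x /ejp [u <-]; rewrite dE iE jrE rj subrr.
have ps x : p (s x) = x.
  have [v <-] := sp x; rewrite sE dE iE jrE linearB.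
  by rewrite (_ : p (j _) = 0) ?subr0 //; apply/ejp; exists (r v).
exists s; split=> //; split.
- by move=> x y e; rewrite -(ps x) e ps.
- move=> x; split=> [rx|[w <-]].
    by exists (p x); rewrite sE dE iE jrE rx linear0 subr0.
  have [v <-] := sp w; rewrite sE dE iE jrE linearB rj subrr //.
- by move=> u; exists (j u).
Qed.

Lemma ses_retraction U V W (j : {linear U -> V}) (p : {linear V -> W})
    (r : {linear V -> U}) : short_exact j p -> (forall x, r (j x) = x) -> ses W V U.
Proof.
by move=> sjp rj; have [s [_ sr]] := short_exact_retraction sjp rj; exists s, r.
Qed.

Lemma ses_prod U W : ses U (U * W)%type W.
Proof.
have [l lE] := linear_inl U W; have [s sE] := linear_snd U W.
exists l, s; split.
- by move=> x y; rewrite !lE => -[].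
- move=> [x y]; rewrite sE /=; split=> [->|[u]]; first by exists x; rewrite lE.
  by rewrite lE => -[].
- by move=> y; exists (0, y); rewrite sE.
Qed.

Lemma ses_zero_l Z U : is_zero_module Z -> ses Z U U.
Proof.
move=> hZ; have [o oE] := linear_zero Z U; have [i iE] := linear_id U.
exists o, i; split.
- by move=> x y _; rewrite (hZ x) (hZ y).
- move=> y; rewrite iE; split=> [->|[x <-]] //; exists 0; exact: linear0.
- by move=> y; exists y.
Qed.

Lemma ses_zero_r Z U : is_zero_module Z -> ses U U Z.
Proof.
move=> hZ; have [o oE] := linear_zero U Z; have [i iE] := linear_id U.
exists i, o; split.
- by move=> x y; rewrite !iE.
- by move=> y; rewrite oE; split=> [_|//]; exists y; rewrite iE.
- by move=> y; exists 0; rewrite linear0 [RHS]hZ.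
Qed.

Lemma ses_of_bij U V Z (f : {linear U -> V}) : is_zero_module Z ->
  injective f -> surjective f -> ses U V Z.
Proof.
move=> hZ fi fs; have [o oE] := linear_zero V Z; exists f, o; split=> //.
by move=> y; exists 0; rewrite linear0 [RHS]hZ.
Qed.

Lemma ses_ffun n U V W : ses U V W ->
  ses {ffun 'I_n -> U} {ffun 'I_n -> V} {ffun 'I_n -> W}.
Proof.
move=> [j [p [ij ejp sp]]].
have [f fE] : exists f : {linear {ffun 'I_n -> U} -> {ffun 'I_n -> V}},
    forall x, f x = [ffun i => j (x i)].
  by apply: linear_ex => a x y; apply/ffunP => i; rewrite !ffunE linearP.
have [g gE] : exists g : {linear {ffun 'I_n -> V} -> {ffun 'I_n -> W}},
    forall x, g x = [ffun i => p (x i)].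
  by apply: linear_ex => a x y; apply/ffunP => i; rewrite !ffunE linearP.
exists f, g; split.
- move=> x y; rewrite !fE => /ffunP e; apply/ffunP => i.
  by have := e i; rewrite !ffunE => /ij.
- move=> y; rewrite gE; split=> [/ffunP e|[x <-]].
    have h i : exists u, j u = y i by apply/ejp; have := e i; rewrite !ffunE.
    have [u uE] := choice h; exists (finfun u).
    by rewrite fE; apply/ffunP => i; rewrite !ffunE.
  by apply/ffunP => i; rewrite fE !ffunE; apply/ejp; exists (x i).
- move=> z; have [u uE] := choice (fun i => sp (z i)).
  by exists (finfun u); rewrite gE; apply/ffunP => i; rewrite !ffunE.
Qed.

Lemma zero_ffun0 U : is_zero_module {ffun 'I_0 -> U}.
Proof. by move=> x; apply/ffunP => -[]. Qed.

(** Splitting off one copy drives the inductions on finite powers, and it also gives the embedding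
    of [W 0] into its power in [Gdim_le_reducing]. *)
Lemma ses_ffunS n U : ses U {ffun 'I_n.+1 -> U} {ffun 'I_n -> U}.
Proof.
have [j jE] : exists j : {linear U -> {ffun 'I_n.+1 -> U}},
    forall x, j x = [ffun i => if i == ord0 then x else 0].
  apply: linear_ex => a x y; apply/ffunP => i; rewrite !ffunE.
  by case: ifP => // _; rewrite scaler0 addr0.
have [p pE] : exists p : {linear {ffun 'I_n.+1 -> U} -> {ffun 'I_n -> U}},
    forall x, p x = [ffun i => x (lift ord0 i)].
  by apply: linear_ex => a x y; apply/ffunP => i; rewrite !ffunE.
exists j, p; split.
- by move=> x y; rewrite !jE => /ffunP /(_ ord0); rewrite !ffunE eqxx.
- move=> y; rewrite pE; split=> [/ffunP e|[x <-]].
    exists (y ord0); rewrite jE; apply/ffunP => i; rewrite !ffunE.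
    case: (unliftP ord0 i) => [k|] ->; last by rewrite eqxx.
    by have := e k; rewrite !ffunE => ->.
  by apply/ffunP => i; rewrite !ffunE jE ffunE.
- move=> z; exists [ffun i => if unlift ord0 i is Some k then z k else 0].
  by rewrite pE; apply/ffunP => i; rewrite !ffunE liftK.
Qed.

End ShortExact.

(** * Finitely generated and projective modules *)

Section FinitelyGenerated.
Variable R : pzRingType.
Implicit Types A B C D E F I J K M N P Q T U V W X Y Z : lmodType R.

Definition free n : lmodType R := {ffun 'I_n -> R^o}.

Lemma free_map n M (x : 'I_n -> M) :
  exists f : {linear free n -> M}, forall c : free n, f c = \sum_i (c i : R) *: x i.
Proof.
apply: linear_ex => a c d; rewrite scaler_sumr -big_split /=.
by apply: eq_bigr => i _; rewrite !ffunE scalerDl scalerA.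
Qed.

Definition basis n (i : 'I_n) : free n := [ffun j => if j == i then 1 else 0 : R].

Lemma free_sum n (c : free n) : c = \sum_i (c i : R) *: basis i.
Proof.
apply/ffunP => j; rewrite sum_ffunE (bigD1 j) //= !ffunE eqxx.
rewrite big1 ?addr0; first by rewrite [LHS]/= -[LHS]mulr1.
by move=> i ij; rewrite !ffunE eq_sym (negPf ij) scaler0.
Qed.

Lemma free_lin_sum n M (f : {linear free n -> M}) c :
  f c = \sum_i (c i : R) *: f (basis i).
Proof.
by rewrite {1}[c]free_sum linear_sum; apply: eq_bigr => i _; rewrite linearZ.
Qed.

Lemma free_projective n : projective (free n).
Proof.
move=> U V p f sp; have [u uE] := choice (fun i => sp (f (basis i))).
have [g gE] := free_map u; exists g => c.
by rewrite gE free_lin_sum linear_sum; apply: eq_bigr => i _; rewrite linearZ uE.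
Qed.

Lemma fgP M : finitely_generated M <->
  exists n (f : {linear free n -> M}), surjective f.
Proof.
split=> [[n [x h]]|[n [f sf]]].
  have [f fE] := free_map x; exists n, f => v; have [c ->] := h v.
  by exists (finfun c); rewrite fE; apply: eq_bigr => i _; rewrite ffunE.
exists n, (fun i => f (basis i)) => v; have [c <-] := sf v.
by exists c; rewrite free_lin_sum.
Qed.

Lemma fg_free n : finitely_generated (free n).
Proof. by apply/fgP; have [i iE] := linear_id (free n); exists n, i => v; exists v. Qed.

Lemma fg_surj M N (f : {linear M -> N}) :
  surjective f -> finitely_generated M -> finitely_generated N.
Proof.
move=> sf /fgP [n [g sg]]; apply/fgP; have [h hE] := linear_comp f g.
by exists n, h => v; have [m <-] := sf v; have [c <-] := sg m; exists c; rewrite hE.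
Qed.

Lemma fg_ses_r A B C : ses A B C -> finitely_generated B -> finitely_generated C.
Proof. by move=> [j [p [_ _ sp]]]; apply: fg_surj sp. Qed.

Lemma fg_zero Z : is_zero_module Z -> finitely_generated Z.
Proof. by move=> hZ; exists 0%N, (fun=> 0) => v; exists (fun=> 0); rewrite [LHS]hZ [RHS]hZ. Qed.

Definition fgproj P := finitely_generated P /\ projective P.

Lemma fgproj_free n : fgproj (free n).
Proof. by split; [apply: fg_free | apply: free_projective]. Qed.

Lemma projective_retract P X (p : {linear X -> P}) (s : {linear P -> X}) :
  projective X -> (forall x, p (s x) = x) -> projective P.
Proof.
move=> prX ps U V q f sq; have [fp fpE] := linear_comp f p.
have [g gE] := prX _ _ q fp sq; have [gs gsE] := linear_comp g s.
by exists gs => x; rewrite gsE gE fpE ps.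
Qed.

Lemma fgprojP P : fgproj P <-> exists n (p : {linear free n -> P})
  (s : {linear P -> free n}), forall x, p (s x) = x.
Proof.
split=> [[/fgP [n [p sp]] prP]|[n [p [s ps]]]].
  by have [s sE] := projective_section prP sp; exists n, p, s.
split; last exact: projective_retract (@free_projective n) ps.
by apply/fgP; exists n, p => x; exists (s x).
Qed.

Lemma projective_prod P Q : projective P -> projective Q -> projective (P * Q)%type.
Proof.
move=> prP prQ U V p f sp.
have [l lE] := linear_inl P Q; have [r rE] := linear_inr P Q.
have [fl flE] := linear_comp f l; have [fr frE] := linear_comp f r.
have [gl glE] := prP _ _ p fl sp; have [gr grE] := prQ _ _ p fr sp.
have [g gE] := linear_case gl gr; exists g => -[x y].
rewrite gE linearD glE grE flE frE -linearD lE rE /=; congr (f _).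
by congr pair; rewrite /= ?addr0 ?add0r.
Qed.

Lemma projective_zero Z : is_zero_module Z -> projective Z.
Proof.
move=> hZ U V p f sp; have [o oE] := linear_zero Z U.
by exists o => x; rewrite oE (hZ x) !linear0.
Qed.

Lemma projective_ses A B C : ses A B C -> projective A -> projective C -> projective B.
Proof.
move=> [j [p sjp]] prA prC; have [_ _ sp] := sjp.
have [s sE] := projective_section prC sp.
have [r [rj rs e]] := ses_split_retraction sjp sE.
have [c cE] := linear_case j s; have [d dE] := linear_pair r p.
apply: (projective_retract (p := c) (s := d)) (projective_prod prA prC) _ => x.
by rewrite cE dE -e.
Qed.

(** The noetherian condition, with injections in place of boolean predicates, so that it can be
    transported along maps. *)
Definition fg_submodules M := forall K (j : {linear K -> M}),
  injective j -> finitely_generated K.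

Lemma fg_submodules_noetherian M : noetherian_module M -> fg_submodules M.
Proof.
move=> hM K j ij.
pose S : {pred M} := [pred x | `[< exists y, j y = x >]].
have SP x : x \in S <-> exists y, j y = x by split=> [/asboolP|h]; last apply/asboolP.
have [|n [x xP]] := hM S.
  split; first by apply/SP; exists 0; rewrite linear0.
  move=> a u v /SP [y <-] /SP [z <-]; apply/SP; exists (a *: y + z).
  by rewrite linearP.
have h i : exists y, j y = x i.
  apply/SP/xP; exists (fun k => if k == i then 1 else 0).
  rewrite (bigD1 i) //= eqxx scale1r big1 ?addr0 // => k ki.
  by rewrite (negPf ki) scale0r.
have [y yE] := choice h; exists n, y => v.
have /xP [c jv] : j v \in S by apply/SP; exists v.
exists c; apply: ij; rewrite jv linear_sum.
by apply: eq_bigr => i _; rewrite linearZ yE.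
Qed.

Lemma fg_ses_m A B C : ses A B C -> finitely_generated A -> finitely_generated C ->
  finitely_generated B.
Proof.
move=> [j [p [ij ejp sp]]] /fgP [n [f sf]] /fgP [m [g sg]].
have [s sE] := projective_lift g (@free_projective m) sp.
have [jf jfE] := linear_comp j f.
have [h hE] := linear_case jf s.
have sh : surjective h.
  move=> b; have [c gc] := sg (p b).
  have [|a ja] := (ejp (b - s c)).1; first by rewrite linearB sE gc subrr.
  have [d fd] := sf a; exists (d, c); by rewrite hE jfE /= fd ja subrK.
apply: (fg_surj sh).
exists (n + m)%N, (fun k => match split k with
  inl i => (basis i, 0) | inr i => (0, basis i) end).
move=> [c d]; exists (fun k => match split k with inl i => c i | inr i => d i end).
rewrite big_split_ord /=.
have -> : \sum_(i < n) (match split (lshift m i) with inl i => c i : R | inr i => d i end) *: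
   match split (lshift m i) with inl i => (basis i, 0) | inr i => (0, basis i) end
   = (c, 0) :> (free n * free m)%type.
  have [l lE] := linear_inl (free n) (free m).
  rewrite -lE [in RHS](free_sum c) linear_sum; apply: eq_bigr => i _.
  by rewrite (unsplitK (inl _ i)) linearZ lE.
have -> : \sum_(i < m) (match split (rshift n i) with inl i => c i : R | inr i => d i end) *:
   match split (rshift n i) with inl i => (basis i, 0) | inr i => (0, basis i) end
   = (0, d) :> (free n * free m)%type.
  have [l lE] := linear_inr (free n) (free m).
  rewrite -lE [in RHS](free_sum d) linear_sum; apply: eq_bigr => i _.
  by rewrite (unsplitK (inr _ i)) linearZ lE.
by congr pair; rewrite /= ?addr0 ?add0r.
Qed.

Lemma fgproj_ses A B C : ses A B C -> fgproj A -> fgproj C -> fgproj B.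
Proof.
move=> h [fA prA] [fC prC]; split; first exact: fg_ses_m h fA fC.
exact: projective_ses h prA prC.
Qed.

Lemma fgproj_prod P Q : fgproj P -> fgproj Q -> fgproj (P * Q)%type.
Proof. exact/fgproj_ses/ses_prod. Qed.

Lemma fgproj_zero Z : is_zero_module Z -> fgproj Z.
Proof. by move=> hZ; split; [apply: fg_zero | apply: projective_zero]. Qed.

Lemma ffun_closed (Q : lmodType R -> Prop) :
  (forall Z, is_zero_module Z -> Q Z) ->
  (forall A B C, ses A B C -> Q A -> Q C -> Q B) ->
  forall M n, Q M -> Q {ffun 'I_n -> M}.
Proof.
move=> Q0 Qe M n QM; elim: n => [|n IH]; first exact/Q0/zero_ffun0.
exact: Qe (ses_ffunS n M) QM IH.
Qed.

(** A submodule [K] of [B] is an extension of its image in [C] by its part inside [A]. *)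
Lemma fg_submodules_ses A B C :
  ses A B C -> fg_submodules A -> fg_submodules C -> fg_submodules B.
Proof.
move=> [i [p [ii eip sp]]] hA hC K j ij.
have [pj pjE] := linear_comp p j.
have [I [q [u [sq iu uE]]]] := image_ex pj.
have [K' [k [ik ekq _]]] := ses_of_surj sq.
have [jk jkE] := linear_comp j k.
have [v vE] : exists v : {linear K' -> A}, forall x, i (v x) = jk x.
  apply: linear_factor_inj => // x; apply/eip; rewrite jkE -pjE -uE.
  by rewrite (_ : q (k x) = 0) ?linear0 //; apply/ekq; exists x.
apply: (@fg_ses_m K' K I); first by exists k, q.
  apply: (hA _ v) => x y e; apply: ik; apply: ij.
  by rewrite -!jkE -!vE e.
exact: hC iu.
Qed.

Lemma fg_submodules_surj M N (f : {linear M -> N}) :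
  surjective f -> fg_submodules M -> fg_submodules N.
Proof.
move=> sf hM K j ij.
have [k [p sp]] := ses_of_surj sf.
have [T [a [b [j' [s1 fa _ _ inj]]]]] := pullback_ex j sp.
have [_ _ sb] := s1; apply: (fg_surj sb); apply: (hM _ a).
apply: linear_inj0 => t at0; apply: inj => //; apply: ij.
by rewrite -fa at0 !linear0.
Qed.

Definition noetherian_ring := noetherian_module (R^o : lmodType R).

Hypothesis hR : noetherian_ring.

Lemma fg_submodules_fg M : finitely_generated M -> fg_submodules M.
Proof.
move=> /fgP [n [f sf]]; apply: (fg_submodules_surj sf).
apply: (ffun_closed (Q := fg_submodules) _ _ (M := R^o) n).
- by move=> Z hZ K j ij; apply: fg_zero => x; apply: ij; rewrite (hZ (j x)) linear0.
- exact: fg_submodules_ses.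
- exact: fg_submodules_noetherian.
Qed.

Lemma fg_ses_l A B C : ses A B C -> finitely_generated B -> finitely_generated A.
Proof. by move=> [j [p [ij _ _]]] /fg_submodules_fg h; apply: h ij. Qed.

Lemma fg_cover M : finitely_generated M ->
  exists n K, ses K (free n) M /\ finitely_generated K.
Proof.
move=> /fgP [n [f sf]]; have [K [j s]] := ses_of_surj sf.
have h : ses K (free n) M by exists j, f.
by exists n, K; split=> //; apply: fg_ses_l h (fg_free n).
Qed.

End FinitelyGenerated.

(** * Vanishing of Ext *)

Section ExtVanishing.
Variable R : pzRingType.
Implicit Types A B C D E F I J K M N P Q T U V W X Y Z : lmodType R.

Definition extends_along U V (j : {linear U -> V}) N :=
  forall h : {linear U -> N}, exists g : {linear V -> N}, forall x, g (j x) = h x.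

(* [Ext_vanish N i M] stands for Ext^(i+1)(M, N) = 0 (note the shift),
   for [i = 0] in the sense of Yoneda. *)
Fixpoint Ext_vanish N i M : Prop :=
  if i is i'.+1 then exists K P, [/\ projective P, ses K P M & Ext_vanish N i' K]
  else forall K X (j : {linear K -> X}) (p : {linear X -> M}),
         short_exact j p -> extends_along j N.

Variable N : lmodType R.
Local Notation V := (Ext_vanish N).

(** One well-chosen presentation of [M] decides about all of them. Given another, with middle term
    [X'], form the pullback [T] of [X'] and [X]. As Ext^1(X, N) = 0, the map [h] extends to [g] on
    [T]; the restriction of [g] to [K] extends to [e] on [X]; the difference of [g] and [e] vanishes
    on [K] and descends to [X']. *)
Lemma Ext_vanish0_of_extends K X M (j : {linear K -> X}) (p : {linear X -> M}) :
  short_exact j p -> extends_along j N -> V 0 X -> V 0 M.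
Proof.
move=> s ej VX K' X' j' p' s' h.
have [T [a [b [k [s1 pa ak ext inj]]]]] := pullback_ex p s'.
have [g gE] := VX _ _ _ _ s1 h.
have [ij ejp sp] := s; have [ij' ejp' sp'] := s'.
(* [T] is the pullback of [X'] and [X] over [M]; [l] embeds [K] in it. *)
have [l lE] : exists l : {linear K -> T}, forall x, a (l x) = 0 /\ b (l x) = j x.
  apply: (@linear_of_rel _ _ _ (fun x t => a t = 0 /\ b t = j x)).
  - by move=> x; apply: ext; rewrite linear0; apply/esym/ejp; exists x.
  - by move=> t [a0]; rewrite linear0; apply: inj.
  by move=> c k1 t k2 t' [a1 b1] [a2 b2]; rewrite !linearP a1 a2 b1 b2 scaler0 addr0.
have [gl glE] := linear_comp g l.
have [e eE] := ej gl.
have [eb ebE] := linear_comp e b.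
have [d dE] := linear_sub g eb.
have sa : surjective a.
  by move=> x'; have [x px] := sp (p' x'); have [t [<- _]] := ext _ _ (esym px); exists t.
have [f fE] : exists f : {linear X' -> N}, forall t, f (a t) = d t.
  apply: linear_factor_surj => // t at0.
  have [|x jx] := (ejp (b t)).1; first by rewrite -pa at0 linear0.
  have [a1 b1] := lE x.
  rewrite (_ : t = l x); first by rewrite dE ebE b1 eE glE subrr.
  by apply/subr0_eq/inj; rewrite linearB ?at0 ?a1 ?b1 ?jx subrr.
exists f => x; rewrite -ak fE dE gE ebE.
have [_ ek _] := s1.
have -> : b (k x) = 0 by apply/ek; exists x.
by rewrite linear0 subr0.
Qed.

Lemma Ext_vanish0_projective P : projective P -> V 0 P.
Proof.
move=> prP K X j p s h; have [_ _ sp] := s.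
have [t tE] := projective_section prP sp.
have [r [rj _ _]] := ses_split_retraction s tE.
by have [g gE] := linear_comp h r; exists g => x; rewrite gE rj.
Qed.

Lemma Ext_vanish_projective P i : projective P -> V i P.
Proof.
elim: i P => [|i IH] P prP; first exact: Ext_vanish0_projective.
pose Z := free R 0.
have hZ : is_zero_module Z by apply: zero_ffun0.
exists Z, P; split=> //; first exact: ses_zero_l.
exact/IH/projective_zero.
Qed.

(** In degree one a map is extended in two stages: first to the preimage [Y] of [A] in [X], then to
    [X]. Higher degrees reduce to this by the horseshoe. *)
Lemma Ext_vanish_ext A B C i : ses A B C -> V i A -> V i C -> V i B.
Proof.
elim: i A B C => [|i IH] A B C h.
  move: h => [j [p s]] VA VC K X k q sq h.
  have [ij ejp sp] := s; have [ik ekq sr] := sq.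
  have [pq pqE] := linear_comp p q.
  have [|Y [y sy]] := @ses_of_surj _ _ _ pq.
    by move=> c; have [b <-] := sp c; have [x <-] := sr b; exists x; rewrite pqE.
  have [iy ey _] := sy.
  have [u uE] : exists u : {linear K -> Y}, forall x, y (u x) = k x.
    apply: linear_factor_inj => // x; apply/ey; rewrite pqE.
    by rewrite (_ : q (k x) = 0) ?linear0 //; apply/ekq; exists x.
  have [qy qyE] := linear_comp q y.
  have [v vE] : exists v : {linear Y -> A}, forall x, j (v x) = qy x.
    by apply: linear_factor_inj => // x; apply/ejp; rewrite qyE -pqE; apply/ey; exists x.
  have suv : short_exact u v.
    split.
    - by move=> x x' e; apply: ik; rewrite -!uE e.
    - move=> x; split=> [v0|[z <-]].
        have [|z kz] := (ekq (y x)).1; first by rewrite -qyE -vE v0 linear0.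
        by exists z; apply: iy; rewrite uE.
      by apply: ij; rewrite vE qyE uE linear0; apply/ekq; exists z.
    - move=> a; have [x qx] := sr (j a).
      have [|z yz] := (ey x).1; first by rewrite pqE qx; apply/ejp; exists a.
      by exists z; apply: ij; rewrite vE qyE yz.
  have [g gE] := VA _ _ _ _ suv h.
  have [g' g'E] := VC _ _ _ _ sy g.
  by exists g' => x; rewrite -uE g'E gE.
move=> [KA [PA [prA sA VA]]] [KC [PC [prC sC VC]]].
have [K [s1 s2]] := horseshoe_proj prC h sA sC.
exists K, (PA * PC)%type; split=> //; first exact: projective_prod.
exact: IH s1 VA VC.
Qed.

(** In degree one, [s] lifts [Y] into its pullback along [r], where the extension exists. In higher
    degrees a syzygy of [A] is an extension of [P] by a syzygy of [X]. *)
Lemma Ext_vanish_retract X A (r : {linear X -> A}) (s : {linear A -> X}) P i :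
  projective P -> ses P X A -> (forall x, r (s x) = x) -> V i X -> V i A.
Proof.
move=> prP h rs; case: i => [VX|i [K [Q [prQ hQ VK]]]].
  move=> K Y j p sj h'.
  have [T [a [b [k [s1 pa ak ext inj]]]]] := pullback_ex r sj.
  have [g gE] := VX _ _ _ _ s1 h'.
  have [sp spE] := linear_comp s p.
  have [w wE] : exists w : {linear Y -> T}, forall y, a (w y) = y /\ b (w y) = sp y.
    apply: (@linear_of_rel _ _ _ (fun y t => a t = y /\ b t = sp y)).
    - by move=> y; apply: ext; rewrite spE rs.
    - by move=> t [a0]; rewrite linear0; apply: inj.
    by move=> c k1 t k2 t' [a1 b1] [a2 b2]; rewrite !linearP a1 a2 b1 b2.
  have [gw gwE] := linear_comp g w; exists gw => x; rewrite gwE -gE; congr (g _).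
  have [a1 b1] := wE (j x); have [_ ek _] := s1.
  apply/subr0_eq/inj; first by rewrite linearB a1 ak subrr.
  rewrite linearB b1 spE (short_exact_eq0 sj) linear0 (short_exact_eq0 s1).
  by rewrite subrr.
have [K' [h1 h2]] := ses_comp_surj hQ h.
exists K', Q; split=> //.
exact: Ext_vanish_ext h2 VK (Ext_vanish_projective _ prP).
Qed.

(* The pullback of [B] along a projective cover of [C] is an extension of [B]
   by the syzygy of [C] and splits as the sum of [A] and the cover. *)
Lemma Ext_vanish_ker A B C i : ses A B C -> V i B -> V i.+1 C -> V i A.
Proof.
move=> h VB [K [P [prP hP VK]]].
have [X [hX hX']] := pullback_ses hP h.
have VX := Ext_vanish_ext hX VK VB.
have [j [p s]] := hX'; have [_ _ sp] := s.
have [t tE] := projective_section prP sp.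
have [r [rj _ _]] := ses_split_retraction s tE.
exact: Ext_vanish_retract prP (ses_split_swap s tE) rj VX.
Qed.

(** The kernel of the composite P -> B -> C is an extension of [A] by the syzygy [K] of [B]. *)
Lemma Ext_vanish_coker A B C i : ses A B C -> V i A -> V i.+1 B -> V i.+1 C.
Proof.
move=> h VA [K [P [prP hP VK]]].
have [K' [h1 h2]] := ses_comp_surj hP h.
by exists K', P; split=> //; apply: Ext_vanish_ext h2 VK VA.
Qed.

(** This frees the recursion in [Ext_vanish] from the choice of the syzygy. *)
Lemma Ext_vanish_syzygy K P M i : projective P -> ses K P M -> V i.+1 M <-> V i K.
Proof.
move=> prP h; split=> [VM|VK]; last by exists K, P.
exact: Ext_vanish_ker h (Ext_vanish_projective _ prP) VM.
Qed.

Lemma Ext_vanish_zero Z i : is_zero_module Z -> V i Z.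
Proof. by move=> hZ; apply/Ext_vanish_projective/projective_zero. Qed.

(** * Comparison with Ext computed from projective resolutions *)

Lemma Ext_vanish_resolution M (P : proj_resolution M) i :
  (forall f : {linear term P i.+1 -> N}, cocycle f -> coboundary f) -> V i M.
Proof.
elim: i M P => [|i IH] M P h.
  have sa := @aug_surjective _ _ P; have ea := @aug_exact _ _ P.
  have [K [k sk]] := ses_of_surj sa.
  apply: (Ext_vanish0_of_extends sk); last exact/Ext_vanish_projective/term_projective.
  move=> u; have [ik ek _] := sk.
  have [b bE] : exists b : {linear term P 1 -> K}, forall x, k (b x) = bd P 0 x.
    by apply: linear_factor_inj => // x; apply/ek/ea; exists x.
  have [f fE] := linear_comp u b.
  have [|g gE] := h f.
    move=> x; rewrite fE (_ : b _ = 0) ?linear0 //; apply: ik.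
    by rewrite bE linear0; apply/(@bd_exact _ _ P 0); exists x.
  exists g => x.
  have /ea [y ey] : aug P (k x) = 0 by apply/ek; exists x.
  by rewrite -ey -gE fE; congr (u _); apply: ik; rewrite bE.
have sa := @aug_surjective _ _ P.
have [K [k sk]] := ses_of_surj sa; have [ik ek _] := sk.
have [b bE] : exists b : {linear term P 1 -> K}, forall x, k (b x) = bd P 0 x.
  by apply: linear_factor_inj => // x; apply/ek/(@aug_exact _ _ P); exists x.
have sb : surjective b.
  move=> y; have [|x bx] := (@aug_exact _ _ P (k y)).1; first by apply/ek; exists y.
  by exists x; apply: ik; rewrite bE.
have eb : exact (bd P 1) b.
  move=> y; split=> [b0|[x <-]]; first by apply/(@bd_exact _ _ P 0); rewrite -bE b0 linear0.
  by apply: ik; rewrite bE linear0; apply/(@bd_exact _ _ P 0); exists x.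
pose Q : proj_resolution K := @ProjResolution _ K (fun n => term P n.+1)
  (fun n => bd P n.+1) b (fun n => @term_projective _ _ P n.+1) sb eb
  (fun n => @bd_exact _ _ P n.+1).
exists K, (term P 0); split; [exact: term_projective | by exists k, (aug P) |].
exact: (IH K Q).
Qed.

Hypothesis hR : noetherian_ring R.

Lemma proj_resolution_cons K P M (j : {linear K -> P}) (p : {linear P -> M})
    (Q : proj_resolution K) : projective P -> short_exact j p ->
  exists Q' : proj_resolution M,
    forall i, (forall f : {linear term Q i.+1 -> N}, cocycle f -> coboundary f) ->
       (forall f : {linear term Q' i.+2 -> N}, cocycle f -> coboundary f).
Proof.
move=> prP [ij ejp sp]; have [d dE] := linear_comp j (aug Q).
pose t n : lmodType R := if n is n'.+1 then term Q n' else P.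
pose b n : {linear t n.+1 -> t n} :=
  match n return {linear t n.+1 -> t n} with 0 => d | n'.+1 => bd Q n' end.
have prt n : projective (t n) by case: n => // n; apply: term_projective.
have e0 : exact (b 0%N) p.
  move=> y; split=> [/ejp [x <-]|[x <-]].
    by have [z <-] := (@aug_surjective _ _ Q) x; exists z; rewrite -dE.
  by rewrite /= dE; apply/ejp; exists (aug Q x).
have e1 n : exact (b n.+1) (b n).
  case: n => [|n]; last exact: bd_exact.
  move=> y; rewrite /= dE; split=> [e|/(@aug_exact _ _ Q) ->]; last by rewrite linear0.
  by apply/(@aug_exact _ _ Q); apply: ij; rewrite e linear0.
(* [term Q' i.+2] computes to [term Q i.+1], and likewise for the differentials, so the condition
   transfers by conversion. Degrees start at [i.+1] because [coboundary] has a separate clause in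
   degree 0. *)
by exists (@ProjResolution _ M t b p prt sp e0 e1).
Qed.

Lemma fg_resolution_chain M : finitely_generated M -> exists (K : nat -> lmodType R)
   (n : nat -> nat) (j : forall i, {linear K i.+1 -> free R (n i)})
   (p : forall i, {linear free R (n i) -> K i}),
  K 0%N = M /\ forall i, short_exact (j i) (p i).
Proof.
move=> fM.
pose T := {K : lmodType R | finitely_generated K}.
(* The next syzygy, the rank and both maps are packed together, so that a single choice function can
   be iterated on finitely generated modules. *)
have step (t : T) : exists s : {u : T & {n : nat & ({linear sval u -> free R n} *
    {linear free R n -> sval t})%type}},
    short_exact (projT2 (projT2 s)).1 (projT2 (projT2 s)).2.
  case: t => K fK; have [n [K' [[j [p s]] fK']]] := fg_cover hR fK.
  by exists (existT _ (exist _ K' fK' : T) (existT _ n (j, p))).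
pose F t := projT1 (cid (step t)).
have FE t : short_exact (projT2 (projT2 (F t))).1 (projT2 (projT2 (F t))).2.
  exact: (projT2 (cid (step t))).
pose t := fix t i : T := if i is i'.+1 then projT1 (F (t i')) else exist _ M fM.
exists (fun i => sval (t i)), (fun i => projT1 (projT2 (F (t i)))),
  (fun i => (projT2 (projT2 (F (t i)))).1), (fun i => (projT2 (projT2 (F (t i)))).2).
by split=> // i; apply: FE.
Qed.

Lemma fg_proj_resolution M : finitely_generated M -> inhabited (proj_resolution M).
Proof.
move=> /fg_resolution_chain [K [n [j [p [<- s]]]]].
have h i : exists d : {linear free R (n i.+1) -> free R (n i)},
    forall x, d x = j i (p i.+1 x) by exact: linear_comp.
pose d i := projT1 (cid (h i)).
have dE i x : d i x = j i (p i.+1 x) by exact: (projT2 (cid (h i))).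
have e0 : exact (d 0%N) (p 0%N).
  have [ij ejp sp] := s 0%N; have [_ _ sp1] := s 1%N.
  move=> y; split=> [/ejp [x <-]|[x <-]].
    by have [z <-] := sp1 x; exists z.
  by rewrite dE; apply/ejp; exists (p 1%N x).
have e1 i : exact (d i.+1) (d i).
  have [ij ejp sp] := s i; have [_ ejp1 _] := s i.+1; have [_ _ sp1] := s i.+2.
  move=> y; rewrite dE; split=> [e|[x <-]].
    have [|x jx] := (ejp1 y).1; first by apply: ij; rewrite e linear0.
    by have [z pz] := sp1 x; exists z; rewrite dE pz.
  by rewrite dE (short_exact_eq0 (s i.+1)) linear0.
have [_ _ sp] := s 0%N.
by split; exact: (@ProjResolution _ _ _ d (p 0%N) (fun i => @free_projective _ (n i)) sp e0 e1).
Qed.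

(** From left to right, any resolution serves. In the converse, finite generation over a noetherian
    ring provides one made of finite free modules. *)
Lemma Ext_eq0P M i : finitely_generated M -> Ext_eq0 i.+1 M N <-> V i M.
Proof.
move=> fM; split=> [[P h]|]; first exact: Ext_vanish_resolution h.
elim: i M fM => [|i IH] M fM VM.
  have [P] := fg_proj_resolution fM; exists P => f cf.
  have sa := @aug_surjective _ _ P; have ea := @aug_exact _ _ P.
  have [K [k sk]] := ses_of_surj sa; have [ik ek _] := sk.
  have [b bE] : exists b : {linear term P 1 -> K}, forall x, k (b x) = bd P 0 x.
    by apply: linear_factor_inj => // x; apply/ek/ea; exists x.
  have sb : surjective b.
    move=> y; have [|x bx] := (ea (k y)).1; first by apply/ek; exists y.
    by exists x; apply: ik; rewrite bE.
  have [u uE] : exists u : {linear K -> N}, forall x, u (b x) = f x.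
    apply: linear_factor_surj => // x b0.
    have [|z <-] := (@bd_exact _ _ P 0 x).1; first by rewrite -bE b0 linear0.
    exact: cf.
  have [g gE] := VM _ _ _ _ sk u.
  by exists g => x; rewrite -uE -gE bE.
have [n [K [h fK]]] := fg_cover hR fM.
have [Q hQ] := IH K fK ((Ext_vanish_syzygy i (@free_projective _ n) h).1 VM).
have [j [p s]] := h.
have [Q' hQ'] := proj_resolution_cons Q (@free_projective _ n) s.
by exists Q'; apply: hQ'.
Qed.

End ExtVanishing.

(** * Duals of projective modules, transposes *)

Section Duality.
Variable L : pzRingType.
Implicit Types M P : rmodType L.
Implicit Types I S T : lmodType L.

Local Notation RR := ((L^c)^o : rmodType L).
Local Notation LL := (L^o : lmodType L).

Lemma dual_eval M (x : M) :
  exists ev : {linear dual M -> LL}, forall f : dual M, ev f = dual_fun f x.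
Proof. exact: (@linear_ex L (dual M) LL (fun f => (dual_fun f x : L))). Qed.

Lemma dual_basis P : fgproj P -> exists n (e : 'I_n -> P) (phi : 'I_n -> dual P),
  forall x, x = \sum_i (dual_fun (phi i) x : L^c) *: e i.
Proof.
move=> /fgprojP [n [p [s ps]]].
have h i : exists c : {linear P -> RR}, forall x, c x = s x i.
  by apply: linear_ex => a x y; rewrite linearP !ffunE.
have [c cE] := choice h.
exists n, (fun i => p (basis _ i)), c => x.
rewrite -{1}(ps x) free_lin_sum; apply: eq_bigr => i _.
by rewrite -cE.
Qed.

Lemma dual_sumE M (I : finType) (c : I -> L) (phi : I -> dual M) x :
  dual_fun (\sum_i c i *: phi i) x = \sum_i (c i * (dual_fun (phi i) x : L)) :> L.
Proof.
have [ev evE] := dual_eval x.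
by rewrite -evE linear_sum; apply: eq_bigr => i _; rewrite linearZ evE.
Qed.

Lemma dual_basisE P n (e : 'I_n -> P) (phi : 'I_n -> dual P) :
  (forall x, x = \sum_i (dual_fun (phi i) x : L^c) *: e i) ->
  forall f : dual P, f = \sum_i (dual_fun f (e i) : L) *: phi i.
Proof.
move=> h f; apply: dual_funP => x.
rewrite dual_sumE {1}(h x) linear_sum; apply: eq_bigr => i _.
by rewrite linearZ.
Qed.

Lemma dual_fgproj P : fgproj P -> fgproj (dual P : lmodType L).
Proof.
move=> /dual_basis [n [e [phi h]]]; apply/fgprojP.
have [p pE] := free_map phi.
have [s sE] : exists s : {linear dual P -> free L n},
    forall f : dual P, s f = [ffun i => (dual_fun f (e i) : L)].
  by apply: linear_ex => a f g; apply/ffunP => i; rewrite !ffunE.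
exists n, p, s => f; rewrite pE [RHS](dual_basisE h).
by apply: eq_bigr => i _; rewrite sE ffunE.
Qed.

Lemma dual_separates P x : fgproj P -> (forall f : dual P, dual_fun f x = 0) -> x = 0.
Proof.
move=> /dual_basis [n [e [phi h]]] f0; rewrite (h x) big1 // => i _.
by rewrite f0 scale0r.
Qed.

(** Together with [dual_separates] this is reflexivity of [P]; the dual basis gives [y]
    explicitly. *)
Lemma dual_reflexive P (psi : {linear dual P -> LL}) : fgproj P ->
  exists y, forall f : dual P, psi f = dual_fun f y.
Proof.
move=> /dual_basis [n [e [phi h]]].
exists (\sum_i (psi (phi i) : L^c) *: e i) => f.
rewrite {1}(dual_basisE h f) !linear_sum; apply: eq_bigr => i _.
by rewrite !linearZ.
Qed.

End Duality.

(** * Embeddings of totally reflexive modules into projective modules *)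

Section TotallyReflexive.
Variable L : pzRingType.
Hypothesis hl : left_noetherian L.
Hypothesis hr : right_noetherian L.
Implicit Types A B C D E F G K M N P Q X Y Z : rmodType L.
Implicit Types I S T : lmodType L.

Local Notation RR := ((L^c)^o : rmodType L).
Local Notation LL := (L^o : lmodType L).
Local Notation V := (Ext_vanish RR).

(** The shift in [Ext_vanish] absorbs the condition i >= 1. *)
Definition trefl M := [/\ finitely_generated M, forall i, V i M &
  exists T, is_transpose M T /\ forall i, Ext_vanish LL i T].

Lemma transpose_fg M T : is_transpose M T -> finitely_generated T.
Proof.
move=> [P1 [P0 [f [e [q [hP1 _ _ [_ sq]]]]]]].
by have [fg _] := dual_fgproj hP1; apply: fg_surj sq fg.
Qed.

Lemma totally_reflexiveP M : totally_reflexive M <-> trefl M.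
Proof.
split=> -[fM VM [T [hT VT]]]; have fT := transpose_fg hT; split=> //.
- by move=> i; apply/(Ext_eq0P RR hr i fM)/VM.
- by exists T; split=> // i; apply/(Ext_eq0P LL hl i fT)/VT.
- by case=> // i _; apply/(Ext_eq0P RR hr i fM)/VM.
- by exists T; split=> //; case=> // i _; apply/(Ext_eq0P LL hl i fT)/VT.
Qed.

Lemma Ext_vanish_fgproj C P : V 0 C -> fgproj P -> Ext_vanish P 0 C.
Proof.
move=> VC /fgprojP [n [p [s ps]]] K X j q sj h.
have hi i : exists g : {linear X -> RR}, forall x, g (j x) = s (h x) i.
  have [c cE] : exists c : {linear K -> RR}, forall x, c x = s (h x) i.
    by apply: linear_ex => a x y; rewrite !linearP !ffunE.
  by have [g gE] := VC _ _ _ _ sj c; exists g => x; rewrite gE cE.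
have [g gE] := choice hi.
have [f fE] : exists f : {linear X -> free L^c n}, forall x, f x = [ffun i => g i x].
  by apply: linear_ex => a x y; apply/ffunP => i; rewrite !ffunE linearP.
have [pf pfE] := linear_comp p f; exists pf => x.
rewrite pfE -[RHS]ps; congr (p _); apply/ffunP => i.
by rewrite fE ffunE gE.
Qed.

Lemma dual_map_exact K X M (j : {linear K -> X}) (p : {linear X -> M}) (h : dual X) :
  exact j p -> surjective p -> dual_map j h = 0 ->
  exists g : {linear M -> RR}, forall x, g (p x) = dual_fun h x.
Proof.
move=> ejp sp h0; apply: linear_factor_surj => // x /ejp [k <-].
by have := congr1 (fun u => dual_fun u k) h0.
Qed.

(** The image [I] is isolated because it is at once a syzygy of the transpose [S] and, in
    [trefl_step] and [trefl_coind], a transpose of the cokernel of an embedding of the presented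
    module. *)
Lemma dual_map_coker S (M N : rmodType L) (f : {linear M -> N}) (q : {linear dual M -> S}) :
  exact (dual_map f) q -> surjective q -> exists I (u : {linear dual N -> I})
   (v : {linear I -> dual M}), [/\ surjective u, short_exact v q &
   forall h : dual N, v (u h) = dual_map f h].
Proof.
move=> eq sq; have [I [u [v [su iv vu]]]] := image_ex (dual_map f : {linear dual N -> dual M}).
exists I, u, v; split=> //; split=> // y; split=> [/eq [h <-]|[x <-]].
  by exists (u h); rewrite vu.
by have [h <-] := su x; apply/eq; exists h; rewrite vu.
Qed.

(** The kernel [K] of the dual of [f] is the dual of [M], finitely generated because L is left
    noetherian. Its [n] generators are the coordinates of a map from [M] to a free module, the left
    approximation of [M]. Every functional on [M] is a combination of them, so it extends to the
    free module, and Ext^1(C, L) = 0. Composing P0 -> M -> F presents [C] with transpose [I], a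
    syzygy of [T]. *)
Lemma trefl_step M : trefl M -> exists F C, [/\ ses M F C, fgproj F & trefl C].
Proof.
move=> [fM VM [T [hT VT]]].
have [P1 [P0 [f [e [q [hP1 hP0 [efe se] [edq sq]]]]]]] := hT.
have [I [u [v [su sv vu]]]] := dual_map_coker edq sq.
have [K [k su']] := ses_of_surj su; have [ik eku _] := su'.
have [fgD0 prD0] := dual_fgproj hP0.
have fK : finitely_generated K by apply: fg_ses_l fgD0 => //; exists k, u.
have /fgP [n [g sg]] := fK.
have [w wE] : exists w : {linear P0 -> free L^c n},
    forall x, w x = [ffun i => dual_fun (k (g (basis _ i))) x].
  by apply: linear_ex => a x y; apply/ffunP => i; rewrite !ffunE linearP.
have kf y x : dual_fun (k y) (f x) = 0.
  have : v (u (k y)) = 0 by rewrite (short_exact_eq0 su') linear0.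
  by rewrite vu => /(congr1 (fun h => dual_fun h x)).
have ker (h : dual P0) : dual_map f h = 0 -> exists c : free L n,
    forall x, dual_fun h x = \sum_i (c i * (dual_fun (k (g (basis _ i))) x : L)) :> L.
  move=> h0; have [|y ky] := (eku h).1.
    by have [iv _ _] := sv; apply: iv; rewrite vu h0 linear0.
  have [c gc] := sg y; exists c => x.
  rewrite -[RHS](@dual_sumE L P0 _ (c : _ -> L) (fun i => k (g (basis L i)))) -ky -gc.
  have [kg kgE] := linear_comp k g; rewrite -kgE free_lin_sum.
  by congr (dual_fun _ x); apply: eq_bigr => i _; rewrite kgE.
have [m mE] : exists m : {linear M -> free L^c n}, forall x, m (e x) = w x.
  apply: linear_factor_surj => // x /efe [y <-].
  by rewrite wE; apply/ffunP => i; rewrite !ffunE kf.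
(* If [m] kills [e x], evaluation at [x] kills [K] and so factors through [I]. It extends to the
   dual of [P1] as Ext^1(T, L) = 0, where it is evaluation at some [y]; duals separate points, so
   [x = f y]. *)
have im : injective m.
  apply: linear_inj0 => z; have [x <-] := se z; rewrite mE wE => /ffunP w0.
  have [ev evE] := dual_eval x.
  have [ev' ev'E] : exists ev' : {linear I -> LL}, forall h, ev' (u h) = ev h.
    apply: linear_factor_surj => // h /eku [y <-].
    have [c <-] := sg y; rewrite free_lin_sum !linear_sum big1 // => i _.
    by rewrite !linearZ /= evE; have := w0 i; rewrite !ffunE => ->; rewrite scaler0.
  have [psi psiE] := VT 0%N _ _ _ _ sv ev'.
  have [y yE] := dual_reflexive psi hP1.
  have -> : x = f y.
    apply/subr0_eq/(dual_separates hP0) => h.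
    rewrite linearB -evE -ev'E -psiE vu yE.
    exact: subrr.
  by apply/efe; exists y.
have [C [c sc]] := ses_of_inj im; have hC : ses M (free L^c n) C by exists m, c.
exists (free L^c n), C; split=> //; first exact: fgproj_free.
have [_ emc sc'] := sc.
have ext (h : {linear M -> RR}) : exists d : free L n, forall y,
    h y = \sum_i (d i * (m y i : L)) :> L.
  have [he heE] := linear_comp h e.
  have [|d dE] := ker he.
    apply: dual_funP => x; rewrite /= -[LHS]/(he (f x)) heE.
    by rewrite (_ : e _ = 0) ?linear0 //; apply/efe; exists x.
  exists d => y; have [x <-] := se y.
  rewrite -heE [LHS]dE; apply: eq_bigr => i _; by rewrite mE wE ffunE.
have comb (d : free L n) : exists g' : {linear free L^c n -> RR},
    forall y, g' y = \sum_i (d i * (y i : L)) :> L.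
  exact: (@free_map L^c n RR (fun i => d i)).
split.
- exact: fg_ses_r hC (fg_free _ _).
- case=> [|i].
    apply: (Ext_vanish0_of_extends sc); last exact/Ext_vanish0_projective/free_projective.
    move=> h; have [d dE] := ext h; have [g' g'E] := comb d; exists g' => x.
    by rewrite g'E dE.
  exact: Ext_vanish_coker hC (VM i) (Ext_vanish_projective _ _ (fgproj_free _ n).2).
exists I; split.
  exists P0, (free L^c n), w, c, u; split=> //; first exact: fgproj_free.
    split=> // y; split=> [/emc [z <-]|[x <-]].
      by have [x <-] := se z; exists x; rewrite mE.
    by rewrite -mE; apply/emc; exists (e x).
  split=> // h; split.
    move=> u0; have [|d dE] := ker h; first by rewrite -vu u0 linear0.
    have [g' g'E] := comb d; exists g'; apply: dual_funP => x.
    rewrite dE -[LHS]/(g' (w x)) g'E; apply: eq_bigr => i _.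
    by rewrite wE ffunE.
  move=> [g' <-]; have [iv _ _] := sv; apply: iv; rewrite vu linear0.
  apply: dual_funP => x; rewrite -[LHS]/(g' (w (f x))).
  rewrite (_ : w (f x) = 0) ?linear0 // wE; apply/ffunP => i.
  by rewrite !ffunE kf.
move=> i; apply: (Ext_vanish_ker _ (Ext_vanish_projective _ _ _) (VT i.+1)); first by exists v, q.
by have [_] := dual_fgproj hP1.
Qed.

Lemma transpose_ex M : finitely_generated M -> exists T, is_transpose M T.
Proof.
move=> fM; have [n [K [[k [e [ik ek se]]] fK]]] := fg_cover hr fM.
have /fgP [m [g sg]] := fK.
have [f fE] := linear_comp k g.
have [T [q [sq eq]]] := cokernel_ex (dual_map f : {linear dual (free L^c n) -> dual (free L^c m)}).
exists T, (free L^c m), (free L^c n), f, e, q; split; try exact: fgproj_free => //.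
  split=> // y; split=> [/ek [x <-]|[x <-]].
    by have [z <-] := sg x; exists z; rewrite fE.
  by rewrite fE; apply/ek; exists (g x).
by [].
Qed.

(* For [0 -> M -> F -> C -> 0], a transpose [T] of [M] is the cokernel of a map
   [I -> P1^*] where [I] is a transpose of [C], so that, for i > 0, Ext^(i+1)(T, L) is
   Ext^i(I, L): the vanishing follows by induction on [i], for all members of
   [S] and all their transposes at once. *)
Lemma trefl_coind (S : rmodType L -> Prop) :
  (forall N, S N -> [/\ finitely_generated N, forall i, V i N &
     exists F C, [/\ ses N F C, fgproj F & S C]]) ->
  forall M, S M -> trefl M.
Proof.
move=> hS.
suff main i : forall M T, S M -> is_transpose M T -> Ext_vanish LL i T.
  move=> M SM; have [fM VM _] := hS M SM; split=> //.
  have [T hT] := transpose_ex fM; exists T; split=> // i; exact: main hT.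
elim: i => [|i IH] M T SM [P1 [P0 [f [e [q [hP1 hP0 [efe se] [edq sq]]]]]]].
  have [I [u [v [su sv vu]]]] := dual_map_coker edq sq.
  have [_ prD1] := dual_fgproj hP1.
  apply: (Ext_vanish0_of_extends sv); last exact: Ext_vanish0_projective.
  move=> h; have [hu huE] := linear_comp h u.
  (* Degree one: [h], pulled back to the dual of [P0], is evaluation at [x]. Functionals on [P0]
     coming from [F] die in [I], so they vanish at [x], whence [e x = 0] because [M] embeds in [F].
     Then [x = f y], and evaluation at [y] extends [h]. *)
  have [x xE] := dual_reflexive hu hP0.
  have [_ _ [F [C [[j [p [ij _ _]]] hF _]]]] := hS M SM.
  have /efe [y fy] : e x = 0.
    apply: ij; rewrite linear0; apply: (dual_separates hF) => phi.
    have [d dE] : exists d : {linear P0 -> RR}, forall z, d z = dual_fun phi (j (e z)).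
      by apply: linear_ex => a z z'; rewrite !linearP.
    rewrite -dE -[LHS](xE d) huE.
    rewrite (_ : u _ = 0) ?linear0 //.
    have [iv _ _] := sv; apply: iv; rewrite vu linear0.
    apply: dual_funP => z; rewrite -[LHS]/(d (f z)) dE.
    by rewrite (_ : e _ = 0) ?linear0 //; apply/efe; exists z.
  have [ev evE] := dual_eval y; exists ev => z.
  have [g <-] := su z; rewrite vu evE -huE xE -fy //.
have [I [u [v [su sv vu]]]] := dual_map_coker edq sq.
have [_ prD1] := dual_fgproj hP1.
exists I, (dual P1 : lmodType L); split=> //; first by exists v, q.
have [_ _ [F [C [[j [p sjp]] hF SC]]]] := hS M SM.
have [ij ejp sp] := sjp; have [_ VC _] := hS C SC.
apply: (IH C) => //.
have [w wE] := linear_comp j e.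
exists P0, F, w, p, u; split=> //.
  split=> // y; split=> [/ejp [z <-]|[x <-]].
    by have [x <-] := se z; exists x; rewrite wE.
  by rewrite wE; apply/ejp; exists (e x).
split=> // h; split.
  move=> u0; have h0 : dual_map f h = 0 by rewrite -vu u0 linear0.
  have [d dE] := dual_map_exact efe se h0.
  have [g gE] := VC 0%N _ _ _ _ sjp d.
  by exists g; apply: dual_funP => x; rewrite -[LHS]/(g (w x)) wE gE dE.
move=> [g <-]; have [iv _ _] := sv; apply: iv; rewrite vu linear0.
apply: dual_funP => x; rewrite -[LHS]/(g (w (f x))) wE.
by rewrite (_ : e _ = 0) ?linear0 //; apply/efe; exists x.
Qed.

End TotallyReflexive.

(** * Extension closures and Gorenstein dimension *)

Section Closure.
Variable L : pzRingType.
Hypothesis hl : left_noetherian L.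
Hypothesis hr : right_noetherian L.
Implicit Types A B C D E F G H K M N P Q U W X Y Z : rmodType L.
Implicit Types S : rmodType L -> Prop.

Local Notation RR := ((L^c)^o : rmodType L).
Local Notation V := (Ext_vanish RR).
Local Notation TR := (@trefl L).

Inductive ext_closure S : rmodType L -> Prop :=
| ext_closure_incl X : S X -> ext_closure S X
| ext_closure_ses A B C : ses A B C -> ext_closure S A -> ext_closure S C ->
    ext_closure S B.

(** The coinduction is run on the closure itself. For an extension [B] of [C] by [A], the embedding
    of [A] into [FA] extends to [B] because Ext^1(C, FA) = 0; the cohorseshoe then gives a cokernel
    that is an extension of [C'] by [A']. *)
Lemma ext_closure_trefl S :
  (forall X, S X -> [/\ finitely_generated X, forall i, V i X &
     exists F C, [/\ ses X F C, fgproj F & ext_closure S C]]) ->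
  forall X, ext_closure S X -> TR X.
Proof.
move=> hS X; apply: (trefl_coind hr) => {}X.
elim=> {X} [X /hS|A B C [j [p s]] _ [fA VA [FA [A' [[jA [qA sA]] hFA eA]]]]
  _ [fC VC [FC [C' [hC hFC eC]]]]] //.
have hB : ses A B C by exists j, p.
split.
- exact: fg_ses_m hB fA fC.
- by move=> i; apply: Ext_vanish_ext hB (VA i) (VC i).
have [t tE] := Ext_vanish_fgproj (VC 0%N) hFA s jA.
have [D [h1 h2]] := cohorseshoe s sA hC tE.
exists (FA * FC)%type, D; split=> //; first exact: fgproj_prod.
exact: ext_closure_ses h1 eA eC.
Qed.

(* A cokernel [Y] of an embedding of [X] into a totally reflexive [G] is replaced
   by the cokernel of [X -> G -> F], an extension of [G'] by [Y] where
   [0 -> G -> F -> G' -> 0] has totally reflexive [G']. *)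
Lemma trefl_ext_closure S :
  (forall X, S X -> [/\ finitely_generated X, forall i, V i X &
     exists G Y, [/\ ses X G Y, TR G & ext_closure (fun Z => S Z \/ TR Z) Y]]) ->
  forall X, ext_closure (fun Z => S Z \/ TR Z) X -> TR X.
Proof.
move=> hS; apply: ext_closure_trefl => X [SX|tX].
  have [fX VX [G [Y [hXG tG eY]]]] := hS X SX; split=> //.
  have [F [C [hG hF tC]]] := trefl_step hl tG.
  have [E [h1 h2]] := ses_comp_inj hXG hG.
  exists F, E; split=> //; apply: ext_closure_ses h2 eY _.
  by apply: ext_closure_incl; right.
have [fX VX _] := tX; split=> //.
have [F [C [hX hF tC]]] := trefl_step hl tX.
by exists F, C; split=> //; apply: ext_closure_incl; right.
Qed.

(** Already for empty [S] the closure contains all extensions of totally reflexive modules. *)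
Lemma trefl_ext A B C : ses A B C -> TR A -> TR C -> TR B.
Proof.
move=> h tA tC; apply: (@trefl_ext_closure (fun=> False)) => //.
by apply: ext_closure_ses h _ _; apply: ext_closure_incl; right.
Qed.

(** The class is the singleton of [K], which embeds in [G] with totally reflexive cokernel [X]. *)
Lemma trefl_ker K G X : ses K G X -> TR G -> TR X -> TR K.
Proof.
move=> h tG tX; have [fG VG _] := tG; have [_ VX _] := tX.
apply: (@trefl_ext_closure (fun Z => Z = K)); last by apply: ext_closure_incl; left.
move=> _ ->; split; first exact: fg_ses_l h fG.
  by move=> i; apply: Ext_vanish_ker h (VG i) (VX i.+1).
by exists G, X; split=> //; apply: ext_closure_incl; right.
Qed.

(** Each such module embeds in itself with zero cokernel, which is again in the class. *)
Lemma trefl_fgproj P : fgproj P -> TR P.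
Proof.
move: P; apply: (trefl_coind hr) => P hP; have [fP prP] := hP.
split=> //; first by move=> i; apply: Ext_vanish_projective.
exists P, (free L^c 0); split=> //; last exact: fgproj_free.
exact/ses_zero_r/zero_ffun0.
Qed.

Lemma trefl_zero Z : is_zero_module Z -> TR Z.
Proof. by move=> hZ; apply/trefl_fgproj/fgproj_zero. Qed.

Lemma trefl_iso Z A B : is_zero_module Z -> ses A B Z -> TR A -> TR B.
Proof. by move=> hZ h tA; apply: trefl_ext h tA (trefl_zero hZ). Qed.

(** Embed [K] in a projective [F] and push out: [T] is an extension of [C] by [G], hence totally
    reflexive, and an extension of [X] by [F]. The latter splits because Ext^1(X, F) = 0, so [X] is
    the kernel of a surjection from [T] onto [F]. *)
Lemma trefl_coker K G X : ses K G X -> TR K -> TR G -> V 0 X -> TR X.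
Proof.
move=> h tK tG VX.
have [F [C [hK hF tC]]] := trefl_step hl tK.
have [T [h1 h2]] := pushout_ses h hK.
have tT : TR T by apply: trefl_ext h2 tG tC.
have [j [p s]] := h1.
have [i iE] := linear_id F.
have [r rE] := Ext_vanish_fgproj VX hF s i.
have hX : ses X T F by apply: (ses_retraction (r := r) s) => x; rewrite rE iE.
exact: trefl_ker hX tT (trefl_fgproj hF).
Qed.

(** * Bounds on the Gorenstein dimension *)

Fixpoint Gdim_le n M : Prop :=
  if n is n'.+1 then exists W G, [/\ ses W G M, TR G & Gdim_le n' W] else TR M.

Lemma Gdim_le_split n W X P : ses W X P -> fgproj P -> Gdim_le n W -> Gdim_le n X.
Proof.
move=> h hP; case: n => [|n].
  by move=> tW; apply: trefl_ext h tW (trefl_fgproj hP).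
move=> [Z [G [hW tG gZ]]]; have [_ prP] := hP.
have hP0 : ses (free L^c 0) P P by apply/ses_zero_l/zero_ffun0.
have [K [h1 h2]] := horseshoe_proj prP h hW hP0.
exists K, (G * P)%type; split=> //; first exact: trefl_ext (ses_prod _ _) tG (trefl_fgproj hP).
have h0 : is_zero_module (free L^c 0) by apply: zero_ffun0.
(* [K] is an extension of a zero module by [Z], hence isomorphic to it; the bound is carried across
   this isomorphism. *)
clear -gZ h1 h0 hr hl; case: n gZ => [|n] /=.
  by move=> tZ; apply: trefl_iso h0 h1 tZ.
move=> [W [G [hZ tG gW]]].
move: h1 hZ => [j [p [ij ejp _]]] [u [v [iu euv sv]]].
have [jv jvE] := linear_comp j v.
exists W, G; split=> //; exists u, jv; split=> //.
- move=> y; rewrite jvE -(euv y); split=> [e|->]; last exact: linear0.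
  by apply: ij; rewrite e linear0.
- move=> k; have /ejp [z <-] : p k = 0 by apply: h0.
  by have [y <-] := sv z; exists y; rewrite jvE.
Qed.

(** The pullback [X] of the two covers of [M] is a sum of [W'] and [P], so it inherits the bound,
    and [W] is the kernel of X -> G. Composing a totally reflexive cover of [X] with this map gives
    one of [W]: its kernel [U] maps onto [W] with kernel [Z]. *)
Lemma Gdim_le_syzygy n W P M : ses W P M -> fgproj P -> Gdim_le n.+1 M -> Gdim_le n W.
Proof.
move=> h hP [W' [G [h' tG gW']]].
have [X [h1 h2]] := pullback_ses h' h.
have gX := Gdim_le_split h1 hP gW'.
case: n gW' gX => [|n] _ gX.
  exact: trefl_ker h2 gX tG.
have [Z [H [hX tH gZ]]] := gX.
have [U [h3 h4]] := ses_comp_surj hX h2.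
by exists Z, U; split=> //; apply: trefl_ker h3 tH tG.
Qed.

Lemma Gdim_le_fg n M : Gdim_le n M -> finitely_generated M.
Proof.
case: n => [|n]; first by case.
by move=> [W [G [h [fG _ _] _]]]; apply: fg_ses_r h fG.
Qed.

Lemma Gdim_le_Ext_vanish n M : Gdim_le n M -> forall i, (n <= i)%N -> V i M.
Proof.
elim: n M => [|n IH] M; first by move=> [_ VM _] i _; apply: VM.
move=> [W [G [h [_ VG _] gW]]] [|i] // ni.
exact: Ext_vanish_coker h (IH W gW i ni) (VG i.+1).
Qed.

(** The vanishing passes to [W], which is totally reflexive by induction; then Ext^1(M, L) = 0 makes
    [trefl_coker] applicable. *)
Lemma Gdim_le_perp n M : Gdim_le n M -> (forall i, V i M) -> TR M.
Proof.
elim: n M => [|n IH] M //= [W [G [h tG gW]]] VM.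
have [_ VG _] := tG.
apply: (trefl_coker h _ tG (VM 0%N)).
by apply: IH gW _ => i; apply: Ext_vanish_ker h (VG i) (VM i.+1).
Qed.


(** Passing to a syzygy lowers [n], and also [d] while it is positive; at [n = 0] the previous lemma
    applies. *)
Lemma Gdim_le_of_Ext_vanish d n M : Gdim_le d M -> (forall i, (n <= i)%N -> V i M) ->
  Gdim_le n M.
Proof.
elim: n d M => [|n IH] d M gM VM.
  by apply: Gdim_le_perp gM _ => i; apply: VM.
have fM := Gdim_le_fg gM; have [m [W [h fW]]] := fg_cover hr fM.
have hP := fgproj_free L^c m; exists W, (free L^c m); split=> //.
  exact: trefl_fgproj.
have VW i : (n <= i)%N -> V i W by move=> ni; apply/(Ext_vanish_syzygy _ _ hP.2 h)/VM.
case: d gM => [tM|d gM]; last exact: IH (Gdim_le_syzygy h hP gM) VW.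
have tW : TR W by apply: trefl_ker h _ tM; apply: trefl_fgproj.
exact: (IH 0%N W tW VW).
Qed.

(** A coherent choice of all syzygies of [W 0] at once, since the class of the descent contains
    every one of them. *)
Record syzygy_chain (W : nat -> rmodType L) := SyzygyChain {
  cover : nat -> rmodType L;
  cover_fgproj : forall i, fgproj (cover i);
  cover_ses : forall i, ses (W i.+1) (cover i) (W i)
}.

Lemma syzygy_chain_Ext_vanish (W : nat -> rmodType L) i k :
  syzygy_chain W -> V (i + k) (W 0%N) -> V i (W k).
Proof.
move=> [P hP hW]; elim: k i => [|k IH] i; first by rewrite addn0.
by rewrite addnS -addSn => /IH; apply: (Ext_vanish_syzygy _ _ (hP k).2 (hW k)).1.
Qed.

Lemma syzygy_chain_fg (W : nat -> rmodType L) k : syzygy_chain W -> finitely_generated (W 0%N) ->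
  finitely_generated (W k).
Proof.
move=> [P hP hW] f0; elim: k => [|k _] //.
by apply: fg_ses_l (hW k) (hP k).1.
Qed.

Lemma fgproj_ffun n P : fgproj P -> fgproj {ffun 'I_n -> P}.
Proof. by apply: ffun_closed; [exact: fgproj_zero | exact: fgproj_ses]. Qed.

Lemma Ext_vanish_ffun i n M : V i M -> V i {ffun 'I_n -> M}.
Proof.
apply: (ffun_closed (Q := V i)); first by move=> Z; apply: Ext_vanish_zero.
by move=> A B C; apply: Ext_vanish_ext.
Qed.

Lemma ext_closure_ffun S n M : ext_closure (fun Z => S Z \/ TR Z) M ->
  ext_closure (fun Z => S Z \/ TR Z) {ffun 'I_n -> M}.
Proof.
apply: ffun_closed => [Z hZ|A B C h]; last exact: ext_closure_ses.
by apply: ext_closure_incl; right; apply: trefl_zero.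
Qed.

(* The horseshoe lemma lowers [n] to 0.  Then [B] is totally reflexive, [W 0] embeds
   in it with cokernel an extension of [(W k)^b] by [(W 0)^(a-1)], and [W (j+1)]
   embeds in a projective with cokernel [W j]. *)
Lemma Gdim_le_reducing n a b k (W : nat -> rmodType L) B : (0 < a)%N -> syzygy_chain W ->
  finitely_generated (W 0%N) -> (forall i, (n <= i)%N -> V i (W 0%N)) ->
  ses {ffun 'I_a -> W 0%N} B {ffun 'I_b -> W k} -> Gdim_le n B -> Gdim_le n (W 0%N).
Proof.
move=> a0; elim: n W B => [|n IH] W B hW fW VW h gB; last first.
  have [P hP sP] := hW.
  (* The syzygy [K] of [B] lies between powers of [W 1] and [W k.+1], the terms 0 and [k] of the
     shifted chain, so [a], [b] and [k] stay fixed. *)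
  have [K [h1 h2]] := horseshoe_proj (fgproj_ffun b (hP k)).2 h
    (ses_ffun a (sP 0%N)) (ses_ffun b (sP k)).
  exists (W 1%N), (P 0%N); split=> //; first exact/trefl_fgproj.
  have hW' : syzygy_chain (fun i => W i.+1).
    by exists (fun i => P i.+1) => i; [apply: hP | apply: sP].
  apply: (IH (fun i => W i.+1) K hW') => //.
  - exact: syzygy_chain_fg hW fW.
  - by move=> i ni; apply: (syzygy_chain_Ext_vanish hW); rewrite addn1; apply: VW.
  apply: Gdim_le_syzygy h2 _ gB; apply: fgproj_prod; exact: fgproj_ffun.
apply: (@trefl_ext_closure (fun X => exists j, X = W j)); last first.
  by apply: ext_closure_incl; left; exists 0%N.
move=> _ [j ->].
have [P hP sP] := hW.
have VWj i : V i (W j) by apply: (syzygy_chain_Ext_vanish hW); apply: VW.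
split=> //; first exact: syzygy_chain_fg hW fW.
case: j {VWj} => [|j]; last first.
  exists (P j), (W j); split=> //; first exact/trefl_fgproj.
  by apply: ext_closure_incl; left; exists j.
case: a a0 h => // a _ h.
have [Y [h1 h2]] := ses_comp_inj (ses_ffunS a (W 0%N)) h.
exists B, Y; split=> //.
apply: ext_closure_ses h2 _ _; apply: ext_closure_ffun; apply: ext_closure_incl; left.
  by exists 0%N.
by exists k.
Qed.

End Closure.

(** * Complexes of totally reflexive modules *)

Section Complexes.
Variable L : pzRingType.
Hypothesis hl : left_noetherian L.
Hypothesis hr : right_noetherian L.
Implicit Types K M N X Y : rmodType L.

Local Notation RR := ((L^c)^o : rmodType L).
Local Notation V := (Ext_vanish RR).
Local Notation TR := (@trefl L).

Lemma trefl_split_complex M : TR M -> exists d : {linear (M * M)%type -> (M * M)%type},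
  [/\ TR (M * M)%type, exact d d, exact (dual_map d) (dual_map d) &
      exists phi : {linear M -> (M * M)%type}, injective phi /\ range phi = range d].
Proof.
move=> tM; have [d dE] : exists d : {linear (M * M)%type -> (M * M)%type},
    forall x, d x = (0, x.1).
  by apply: linear_ex => a x y; congr pair; rewrite /= ?scaler0 ?addr0.
have [r rE] := linear_inr M M.
exists d; split.
- exact: (trefl_ext hl hr (ses_prod M M) tM tM).
- move=> [x y]; rewrite dE /=; split=> [[->]|[z]]; first by exists (y, 0); rewrite dE.
  by rewrite dE => -[<-].
- move=> h; split=> [h0|[g <-]]; last first.
    apply: dual_funP => x; rewrite -[LHS]/(dual_fun g (d (d x))).
    by rewrite !dE /=; apply: linear0.
  (* A functional whose composite with [d] is zero vanishes on the second factor, so it is the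
     composite of [d] with z |-> h (z.2, 0). *)
  have [g gE] : exists g : {linear (M * M)%type -> RR}, forall z, g z = dual_fun h (z.2, 0).
    apply: linear_ex => a x y; rewrite -linearP; congr (dual_fun h _).
    by congr pair; rewrite /= ?scaler0 ?addr0.
  exists g; apply: dual_funP => -[x y]; rewrite -[LHS]/(g (d (x, y))) gE dE /=.
  have h1 : dual_fun h (d (y, 0)) = 0 by have := congr1 (fun u => dual_fun u (y, 0)) h0.
  rewrite -[LHS]addr0 -h1 dE -linearD; congr (dual_fun h _).
  by congr pair; rewrite /= ?addr0 ?add0r.
exists r; split=> [x y|]; first by rewrite !rE => -[].
apply/seteqP; split=> y /= [x _ <-]; first by exists (x, 0); rewrite // dE rE.
by exists x.1; rewrite // dE rE.
Qed.

Section Image.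
Variables (G : int -> rmodType L) (d : forall i : int, {linear G i -> G (i - 1)}).
Hypothesis tG : forall i, TR (G i).
Hypothesis ex : forall i, exact (d i) (d (i - 1)).
Hypothesis dex : forall i, exact (dual_map (d (i - 1))) (dual_map (d i)).

(** Images are taken up to isomorphism, so that [M] itself is one. *)
Definition complex_image (i : int) X : Prop :=
  exists phi : {linear X -> G (i - 1)},
    injective phi /\ forall y, (exists x, phi x = y) <-> exists z, d i z = y.

(* Writing an index as [j - 1] avoids transports between [G (i + 1 - 1)] and [G i]. *)
Lemma int_pred (i : int) : exists j : int, i = j - 1.
Proof. by exists (i + 1); rewrite addrK. Qed.

Lemma complex_image_ex i : exists X (q : {linear G i -> X}) (phi : {linear X -> G (i - 1)}),
  [/\ complex_image i X, surjective q, injective phi & forall x, phi (q x) = d i x].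
Proof.
have [X [q [phi [sq ip pq]]]] := image_ex (d i); exists X, q, phi; split=> //.
exists phi; split=> // y; split=> [[x <-]|[z <-]]; last by exists (q z).
by have [z <-] := sq x; exists z.
Qed.

Lemma complex_image_l i X : complex_image i X ->
  exists Y, complex_image (i - 1) Y /\ ses X (G (i - 1)) Y.
Proof.
move=> [phi [iphi phiE]]; have [Y [q [u [hY sq iu uq]]]] := complex_image_ex (i - 1).
exists Y; split=> //; exists phi, q; split=> // y.
rewrite phiE -ex -uq; split=> [->|e]; first by rewrite linear0.
by apply: iu; rewrite e linear0.
Qed.

Lemma complex_image_r j X : complex_image (j - 1) X ->
  exists K (q : {linear G j -> K}) (u : {linear K -> G (j - 1)})
    (p : {linear G (j - 1) -> X}),
  [/\ complex_image j K, surjective q, forall x, u (q x) = d j x & short_exact u p].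
Proof.
move=> [phi [iphi phiE]]; have [K [q [u [hK sq iu uq]]]] := complex_image_ex j.
have [p pE] : exists p : {linear G (j - 1) -> X}, forall x, phi (p x) = d (j - 1) x.
  by apply: linear_factor_inj => // x; apply/phiE; exists x.
exists K, q, u, p; split=> //; split=> //.
- move=> y; split=> [py|[k <-]].
    have /ex [z <-] : d (j - 1) y = 0 by rewrite -pE py linear0.
    by exists (q z).
  apply: iphi; rewrite pE linear0; have [z <-] := sq k.
  by rewrite uq; apply/ex; exists z.
- move=> x; have [|z dz] := (phiE (phi x)).1; first by exists x.
  by exists z; apply: iphi; rewrite pE.
Qed.

(** A functional on [K], composed with [q], is a cocycle of the dual complex, so dual exactness
    extends it along [u]; this settles degree one. Higher degrees shift to the preceding image,
    which is why the induction on [n] leaves [i] free. *)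
Lemma complex_image_Ext_vanish n i X : complex_image i X -> V n X.
Proof.
elim: n i X => [|n IH] i X; have [j ->] := int_pred i => hX.
  have [K [q [u [p [hK sq uq s]]]]] := complex_image_r hX.
  have [_ VG _] := tG (j - 1).
  apply: (Ext_vanish0_of_extends s) (VG 0%N) => h.
  have [l ej] := int_pred j; subst j.
  have [hq hqE] := linear_comp h q.
  have h0 : dual_map (d l) (hq : dual (G (l - 1))) = 0.
    apply: dual_funP => x; rewrite -[LHS]/(hq (d l x)) hqE.
    rewrite (_ : q _ = 0); first exact: linear0.
    have [iu _ _] := s; apply: iu; rewrite uq linear0; apply/ex; by exists x.
  have /dex [g gE] := h0; exists (dual_fun g) => k.
  have [x <-] := sq k; rewrite uq -hqE.
  by have := congr1 (fun f => dual_fun f x) gE.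
have [K [q [u [p [hK sq uq s]]]]] := complex_image_r hX.
have [_ VG _] := tG (j - 1).
have hs : ses K (G (j - 1)) X by exists u, p.
exact: Ext_vanish_coker hs (IH _ _ hK) (VG n.+1).
Qed.

Lemma complex_image_trefl i X : complex_image i X -> TR X.
Proof.
move=> hX; apply: (@trefl_ext_closure L hl hr (fun Z => exists i, complex_image i Z)).
  move=> {i X hX} X [i hX]; have [Y [hY s]] := complex_image_l hX.
  split; first by have [fG _ _] := tG (i - 1); apply: fg_ses_l s fG.
    by move=> n; apply: complex_image_Ext_vanish hX.
  exists (G (i - 1)), Y; split=> //; apply: ext_closure_incl; left.
  by exists (i - 1).
by apply: ext_closure_incl; left; exists i.
Qed.

End Image.

End Complexes.

(** * Reducing chains *)

Section GorensteinDim.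
Variable L : pzRingType.
Hypothesis hl : left_noetherian L.
Hypothesis hr : right_noetherian L.
Implicit Types A B C K M N X Y : rmodType L.

Local Notation RR := ((L^c)^o : rmodType L).
Local Notation V := (Ext_vanish RR).
Local Notation TR := (@trefl L).

Lemma zero_free0 : is_zero_module (free L^c 0).
Proof. exact: zero_ffun0. Qed.

Lemma Gdim_le_of_Gresolution M n : Gresolution_of_length M n -> Gdim_le n M.
Proof.
elim: n M => [|n IH] M [G [d [e [tG zG se e0 e1]]]].
  have /(totally_reflexiveP hl hr) t0 := tG 0%N isT.
  apply: (trefl_iso hl hr zero_free0 _ t0).
  apply: ses_of_bij zero_free0 _ se; apply: linear_inj0 => x /e0 [y <-].
  by rewrite (zG 1%N isT y) linear0.
have [K [k s]] := ses_of_surj se; have [ik ek _] := s.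
exists K, (G 0%N); split; [by exists k, e | exact/(totally_reflexiveP hl hr)/tG |].
have [b bE] : exists b : {linear G 1%N -> K}, forall x, k (b x) = d 0%N x.
  by apply: linear_factor_inj => // x; apply/ek/e0; exists x.
apply: IH; exists (fun i => G i.+1), (fun i => d i.+1), b; split=> //.
- by move=> i ni; apply: tG.
- by move=> i ni; apply: zG.
- move=> y; have [|x dx] := (e0 (k y)).1; first by apply/ek; exists y.
  by exists x; apply: ik; rewrite bE.
move=> y; rewrite -e1 -bE; split=> [->|e2]; first by rewrite linear0.
by apply: ik; rewrite e2 linear0.
Qed.

Lemma Gresolution_of_Gdim_le M n : Gdim_le n M -> Gresolution_of_length M n.
Proof.
elim: n M => [|n IH] M.
  move=> tM; pose Z := free L^c 0.
  pose G i : rmodType L := if i is _.+1 then Z else M.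
  have h i : exists d : {linear G i.+1 -> G i}, forall x, d x = 0 by exact: linear_zero.
  pose d i := projT1 (cid (h i)).
  have dE i x : d i x = 0 by exact: (projT2 (cid (h i))).
  have [e eE] := linear_id M.
  exists G, d, e; split.
  - by case=> // _; apply/(totally_reflexiveP hl hr).
  - by case=> // i _; apply: zero_free0.
  - by move=> y; exists y.
  - by move=> y; rewrite eE; split=> [->|[x <-]]; [exists 0; apply: linear0 | exact (dE 0%N x)].
  - move=> i y; split=> [_|_]; last exact: dE.
    by exists 0; rewrite linear0 [RHS]zero_free0.
move=> [W [G0 [[j [p [ij ejp sp]]] tG0 gW]]].
have [G [d [e [tG zG se e0 e1]]]] := IH W gW.
have [je jeE] := linear_comp j e.
pose G' i : rmodType L := if i is i'.+1 then G i' else G0.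
pose d' i : {linear G' i.+1 -> G' i} :=
  match i return {linear G' i.+1 -> G' i} with 0 => je | i'.+1 => d i' end.
exists G', d', p; split=> //.
- by case=> [|i] ni; [apply/(totally_reflexiveP hl hr) | apply: tG].
- by case=> [|i] ni //; apply: zG.
- move=> y; rewrite ejp /=; split=> -[x <-].
    by have [z <-] := se x; exists z; rewrite jeE.
  by rewrite jeE; exists (e x).
case=> [|i] /=; last exact: e1.
move=> y; rewrite -e0 jeE; split=> [e2|->]; last by rewrite linear0.
by apply: ij; rewrite e2 linear0.
Qed.

Lemma isomorphic_sym M N : isomorphic M N -> isomorphic N M.
Proof.
move=> [f [g fK gK]]; have [i iE] := linear_id M.
have [h hE] : exists h : {linear N -> M}, forall x, h (f x) = i x.
  apply: linear_factor_surj => [y|x fx0]; first by exists (g y).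
  by rewrite -[x]fK fx0 -(linear0 f) fK linear0.
by exists h, f => x; [rewrite -[x]gK hE iE | rewrite hE iE].
Qed.

Lemma isomorphic_ffun n M N : isomorphic M N ->
  isomorphic {ffun 'I_n -> M} {ffun 'I_n -> N}.
Proof.
move=> [f [g fK gK]].
have [h hE] : exists h : {linear {ffun 'I_n -> M} -> {ffun 'I_n -> N}},
    forall x, h x = [ffun i => f (x i)].
  by apply: linear_ex => a x y; apply/ffunP => i; rewrite !ffunE linearP.
exists h, (fun y : {ffun _ -> N} => [ffun i => g (y i)]) => x; apply/ffunP => i.
  by rewrite !ffunE hE ffunE fK.
by rewrite hE !ffunE gK.
Qed.

Lemma ses_isomorphic_r A B C X : ses A B C -> isomorphic C X -> ses A B X.
Proof.
move=> [j [p [ij ejp sp]]] [f [g fK gK]].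
have [fp fpE] := linear_comp f p; exists j, fp; split=> //.
- move=> y; rewrite fpE -ejp; split=> [e|->]; last exact: linear0.
  by rewrite -[p y]fK e -(linear0 f) fK.
- by move=> x; have [y py] := sp (g x); exists y; rewrite fpE py gK.
Qed.

(** [is_nth_syzygy] unfolds from the last syzygy, while chains are extended at the front; this
    converts one recursion into the other. *)
Lemma nth_syzygy_rec k M K : is_nth_syzygy k.+1 M K ->
  exists M', is_syzygy M M' /\ is_nth_syzygy k M' K.
Proof.
elim: k K => [|k IH] K [K' [hK' [P [j [p [fP prP s]]]]]].
  have [j' [p' s']] : ses K P M.
    by apply: ses_isomorphic_r (isomorphic_sym hK'); exists j, p.
  exists K; split; first by exists P, j', p'.
  by have [i iE] := linear_id K; exists i, id => x; rewrite iE.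
have [M' [hM' nM']] := IH K' hK'; exists M'; split=> //.
by exists K'; split=> //; exists P, j, p.
Qed.

Lemma syzygy_chain_cons (W : nat -> rmodType L) P M : syzygy_chain W ->
  fgproj P -> ses (W 0%N) P M ->
  syzygy_chain (fun i => if i is i'.+1 then W i' else M).
Proof.
move=> [Q hQ sQ] hP s; exists (fun i => if i is i'.+1 then Q i' else P).
  by case.
by case.
Qed.

(** The given syzygies are followed up to stage [k] and continued by a free resolution. An
    isomorphism remains at stage [k], where the base case of [is_nth_syzygy] puts one. *)
Lemma syzygy_chain_ex k M K : finitely_generated M -> is_nth_syzygy k M K ->
  exists (W : nat -> rmodType L) (c : syzygy_chain W),
    W 0%N = M /\ isomorphic (W k) K.
Proof.
elim: k M => [|k IH] M fM.
  move=> hK; have [W [n [j [p [e s]]]]] := fg_resolution_chain hr fM.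
  have c : syzygy_chain W.
    exists (fun i => free L^c (n i)) => i; first exact: fgproj_free.
    by exists (j i), (p i).
  by exists W, c; split=> //; rewrite e.
move=> /nth_syzygy_rec [M' [[P [j [p [fP prP s]]]] hK]].
have hs : ses M' P M by exists j, p.
have fM' : finitely_generated M' by apply: fg_ses_l hs fP.
have [W [c [e hW]]] := IH M' fM' hK; rewrite -e in hs.
by exists _, (syzygy_chain_cons c (conj fP prP) hs).
Qed.

Lemma enat_inf_ex (S : set nat) : enat_inf S <> None -> exists n, S n.
Proof.
rewrite /enat_inf; case: pselect => [exS _|_ []] //.
by have [n /asboolP] := exS; exists n.
Qed.

Lemma Gdim_le_of_chain n s M : reducing_chain M s -> finitely_generated M ->
  (forall i, (n <= i)%N -> V i M) -> Gdim_le n M.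
Proof.
elim: s M => [|s IH] M [N [N0 fN stN gN]] fM VM.
  have [d /Gdim_le_of_Gresolution gM] := enat_inf_ex gN.
  by rewrite N0 in gM; apply: Gdim_le_of_Ext_vanish gM VM.
have [k [a [b [K [f [g [a0 b0 nK s0]]]]]]] := stN 0%N isT.
rewrite N0 in f s0 nK; have [W [c [W0 hW]]] := syzygy_chain_ex fM nK.
have h : ses {ffun 'I_a -> W 0%N} (N 1%N) {ffun 'I_b -> W k}.
  rewrite W0; apply: ses_isomorphic_r (isomorphic_ffun b (isomorphic_sym hW)).
  by exists f, g.
rewrite -W0 in fM VM *; apply: (Gdim_le_reducing hl hr a0 c fM VM h).
apply: IH; last first.
- move=> i ni; apply: Ext_vanish_ext h _ _; apply: Ext_vanish_ffun; first exact: VM.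
  by apply: (syzygy_chain_Ext_vanish c); apply: VM; apply: leq_trans ni (leq_addr _ _).
- exact: fN.
by exists (fun i => N i.+1); split=> // i ni; [apply: fN | apply: stN].
Qed.

Lemma redGdim_finite M : redGdim M <> None ->
  (exists d, Gdim_le d M) \/ exists s, reducing_chain M s.
Proof.
rewrite /redGdim; case E : (Gdim M) => [d|] h.
  left; have [|n /Gdim_le_of_Gresolution] := @enat_inf_ex [set n | Gresolution_of_length M n].
    by rewrite -[X in X <> _]/(Gdim M) E.
  by exists n.
by right; have [s []] := enat_inf_ex h; exists s.
Qed.

End GorensteinDim.

Theorem corollary1p2 (L : pzRingType) (hl : left_noetherian L)
    (hr : right_noetherian L) (M : rmodType L) (hM : finitely_generated M) :
  (totally_reflexive M <->
     exists (G : int -> rmodType L) (d : forall i : int, {linear G i -> G (i - 1)}),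
       [/\ forall i, totally_reflexive (G i),
           forall i, exact (d i) (d (i - 1)),
           forall i, exact (dual_map (d (i - 1))) (dual_map (d i)) &
           exists phi : {linear M -> G (0 - 1)},
             injective phi /\ range phi = range (d 0)])
  /\
  (redGdim M <> None ->
     Gdim M = enat_sup [set i : nat | ~ Ext_eq0 i M ((L^c)^o : rmodType L)]).
Proof.
split; first split.
- move=> /(totally_reflexiveP hl hr) tM.
  have [d [tMM ex dex im]] := trefl_split_complex hl hr tM.
  exists (fun=> (M * M)%type : rmodType L), (fun=> d); split=> // i.
  exact/(totally_reflexiveP hl hr).
- move=> [G [d [tG ex dex [phi [iphi rphi]]]]]; apply/(totally_reflexiveP hl hr).
  have tG' i : trefl (G i) by apply/(totally_reflexiveP hl hr).
  apply: (complex_image_trefl hl hr tG' ex dex (i := 0)).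
  exists phi; split=> // y; split=> -[x e].
    by have [z _ <-] : range (d 0) y; [rewrite -rphi; exists x | exists z].
  by have [z _ <-] : range phi y; [rewrite rphi; exists x | exists z].
(* A supremum is by definition the infimum of the upper bounds, so it is enough to identify these
   with the lengths of resolutions. *)
move=> hred; rewrite /Gdim /enat_sup; congr enat_inf.
(* [Ext_vanish] at [i] concerns degree [i.+1], and [n < i.+1] is [n <= i]; degree 0 never exceeds
   [n]. *)
have VM n : (forall i, ~ Ext_eq0 i M ((L^c)^o : rmodType L) -> (i <= n)%N) <->
    forall i, (n <= i)%N -> Ext_vanish ((L^c)^o : rmodType L) i M.
  split=> [h i ni|h i].
    apply/(Ext_eq0P _ hr i hM); apply: contrapT => /h.
    by rewrite ltnNge ni.
  case: i => // i nE; rewrite ltnNge; apply/negP => ni; apply: nE.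
  exact/(Ext_eq0P _ hr i hM)/h.
apply/seteqP; split=> n /=.
  by move=> /(Gdim_le_of_Gresolution hl hr) /Gdim_le_Ext_vanish /VM.
move=> /VM h; apply: Gresolution_of_Gdim_le => //.
have [[m gM]|[s cM]] := redGdim_finite hl hr hred; first exact: Gdim_le_of_Ext_vanish gM h.
exact: Gdim_le_of_chain cM hM h.
Qed.
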